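(* Let $k>0$, $c\in\mathbb{R}$, $x>0$, and let $\alpha,\lambda,v\in\mathbb{C}$ be such that $\Re(v)>-1$, $\Re(\alpha)>0$ and $\Re(\lambda+v)>0$. Then $$\left(I_{0+}^{\alpha}\,t^{\frac{\lambda}{k}-1}W_{v,c}^{k}(t)\right)(x)=\frac{x^{\frac{v}{k}+\frac{\lambda}{k}+\alpha-1}}{(2k)^{\frac{v}{k}}}\;{}_1\Psi_{2}\left[\begin{array}{c}\left(\frac{v}{k}+\frac{\lambda}{k},2\right)\\ \left(\frac{v}{k}+\frac{\lambda}{k}+\alpha,2\right),\left(\frac{v}{k}+1,1\right)\end{array};-\frac{cx^2}{4k}\right].$$
   Context: The left-sided Riemann–Liouville fractional integral of order $\alpha\in\mathbb{C}$, $\Re(\alpha)>0$, is, for $x>0$, $$\left(I_{0+}^{\alpha}f\right)(x)=\frac{1}{\Gamma(\alpha)}\int_0^x (x-t)^{\alpha-1}f(t)\,dt.$$ The notation $\left(I_{0+}^{\alpha}g(t)\right)(x)$ means the operator applied to $t\mapsto g(t)$ on $(0,\infty)$ and evaluated at $x$. The $k$-Bessel function is $$W_{v,c}^{k}(z)=\sum_{n=0}^{\infty}\frac{(-c)^n}{\Gamma_k(nk+v+k)\,n!}\left(\frac{z}{2}\right)^{2n+\frac{v}{k}},$$ where $\Gamma_k(z)=\int_0^\infty t^{z-1}e^{-t^k/k}\,dt$ for $\Re(z)>0$, extended by $\Gamma_k(z)=k^{\frac{z}{k}-1}\Gamma\left(\frac{z}{k}\right)$. The Wright type hypergeometric function is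 $${}_p\Psi_q\left[\begin{array}{c}(a_1,A_1),\dots,(a_p,A_p)\\(b_1,B_1),\dots,(b_q,B_q)\end{array};z\right]=\sum_{n=0}^\infty\frac{\Gamma(a_1+A_1n)\cdots\Gamma(a_p+A_pn)}{\Gamma(b_1+B_1n)\cdots\Gamma(b_q+B_qn)}\frac{z^n}{n!},$$ with $A_i,B_j>0$ real and $1+\sum_j B_j-\sum_i A_i>0$. Reciprocals $1/\Gamma$ and $1/\Gamma_k$ are taken to be $0$ at the poles. Complex powers of positive reals are $y^s=e^{s\log y}$. *)

(* Defs.v *)
From mathcomp Require Import all_boot all_order all_algebra.
From mathcomp Require Import complex.
From mathcomp Require Import all_classical all_reals all_analysis.
Import Order.TTheory GRing.Theory Num.Theory.
Import numFieldNormedType.Exports.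

Set Implicit Arguments.
Unset Strict Implicit.
Unset Printing Implicit Defensive.

Local Open Scope classical_set_scope.
Local Open Scope ring_scope.
Local Open Scope complex_scope.

Definition cexp (R : realType) (z : R[i]) : R[i] :=
  (expR (complex.Re z))%:C * (cos (complex.Im z) +i* sin (complex.Im z)).

(* Only meaningful for 0 < y (ln is 0 on nonpositive reals). *)
Definition cpow (R : realType) (y : R) (s : R[i]) : R[i] := cexp (s * (ln y)%:C).

Definition cintegrable (R : realType) (D : set R) (f : R -> R[i]) : Prop :=
  (@lebesgue_measure R).-integrable D (fun t => (complex.Re (f t))%:E) /\
  (@lebesgue_measure R).-integrable D (fun t => (complex.Im (f t))%:E).

Definition cintegral (R : realType) (D : set R) (f : R -> R[i]) : R[i] :=
  Rintegral (@lebesgue_measure R) D (fun t => complex.Re (f t)) +i*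
  Rintegral (@lebesgue_measure R) D (fun t => complex.Im (f t)).

(* R[i]^o is R[i] with the topology of the complex modulus. *)
Definition csummable (R : realType) (u : nat -> R[i]) : Prop :=
  cvgn (series (u : nat -> R[i]^o)).

Definition csum (R : realType) (u : nat -> R[i]) : R[i] :=
  limn (series (u : nat -> R[i]^o)).

Definition euler_gamma (R : realType) (z : R[i]) : R[i] :=
  cintegral `]0, +oo[ (fun t => cpow t (z - 1) * (expR (- t))%:C).

(* Least m such that 0 < Re z + m. *)
Definition gamma_shift (R : realType) (z : R[i]) : nat :=
  if 0 < complex.Re z then 0%N else (Num.truncn (- complex.Re z)).+1.

(* Continuation by Gamma(z) = Gamma(z + m) / (z (z + 1) ... (z + m - 1)).
   At a pole the denominator vanishes, so that Gamma z = 0 and hence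
   (Gamma z)^-1 = 0, which is the value of the entire function 1/Gamma. *)
Definition Gamma (R : realType) (z : R[i]) : R[i] :=
  euler_gamma (z + (gamma_shift z)%:R) / \prod_(i < gamma_shift z) (z + i%:R).

(* As for Gamma, (Gammak k z)^-1 = 0 at the poles. *)
Definition Gammak (R : realType) (k : R) (z : R[i]) : R[i] :=
  if 0 < complex.Re z then
    cintegral `]0, +oo[ (fun t => cpow t (z - 1) * (expR (- (t `^ k / k)))%:C)
  else cpow k (z / k%:C - 1) * Gamma (z / k%:C).

Definition kBessel_term (R : realType) (k c : R) (v : R[i]) (t : R) (n : nat)
    : R[i] :=
  ((- c) ^+ n)%:C / (Gammak k (n%:R * k%:C + v + k%:C) * n`!%:R)
    * cpow (t / 2) ((2 * n)%:R + v / k%:C).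

(* Restricted to real arguments t > 0. *)
Definition kBessel (R : realType) (k c : R) (v : R[i]) (t : R) : R[i] :=
  csum (kBessel_term k c v t).

(* The parameters (a_i, A_i) and (b_j, B_j) are given as lists of pairs. *)
Definition Wright_term (R : realType) (a b : seq (R[i] * R)) (z : R[i])
    (n : nat) : R[i] :=
  (\prod_(p <- a) Gamma (p.1 + (p.2 * n%:R)%:C))
    / (\prod_(p <- b) Gamma (p.1 + (p.2 * n%:R)%:C)) * (z ^+ n / n`!%:R).

Definition Wright (R : realType) (a b : seq (R[i] * R)) (z : R[i]) : R[i] :=
  csum (Wright_term a b z).

Definition RL_integrand (R : realType) (alpha : R[i]) (f : R -> R[i]) (x t : R)
    : R[i] :=
  cpow (x - t) (alpha - 1) * f t.

Definition RL_integral (R : realType) (alpha : R[i]) (f : R -> R[i]) (x : R)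
    : R[i] :=
  (Gamma alpha)^-1 * cintegral `]0, x[ (RL_integrand alpha f x).

(* Main.v *)
Require Import Defs.
From mathcomp Require Import all_boot all_order all_algebra.
From mathcomp Require Import complex.
From mathcomp Require Import all_classical all_reals all_analysis.
From mathcomp Require Import measurable_realfun ring.
Import Order.TTheory GRing.Theory Num.Theory.
Import numFieldNormedType.Exports.
Import Normc.
Local Open Scope classical_set_scope.
Local Open Scope ring_scope.
Local Open Scope complex_scope.
Set Implicit Arguments.
Unset Strict Implicit.
Unset Printing Implicit Defensive.

(** The n-th term of the series [t^(lambda/k - 1) W(t)] is a constant times
    [t^(s_n - 1)], where [s_n = (v + lambda)/k + 2n], and the fractional integral
    of a power is a Beta integral ([RL_power]):
      [int_0^x (x - t)^(a-1) t^(s-1) dt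
         = x^(a+s-1) Gamma(a) Gamma(s) / Gamma(a+s)].
    Since [Gamma_k(z) = k^(z/k - 1) Gamma(z/k)] ([GammakE]), the integral of the
    n-th term is the n-th term of the Wright series times a factor that does not
    depend on n ([RL_kBessel_term]).  Sum and integral may be exchanged by
    dominated convergence ([cintegral_series]): on ]0, x[ the n-th term is at
    most [M y^n / n!] times the weight
    [(x - t)^(Re a - 1) t^(Re (v + lambda)/k - 1)], which is integrable because
    both exponents exceed -1.  This also gives the integrability and the
    summability claims.

    What carries the argument is the theory of the Gamma integral at complex
    arguments of positive real part.

    - The Beta identity ([gamma_beta]) is Fubini's theorem for
      [t^(a+b-1) w^(b-1) e^(-t(1+w))] on the quadrant: integrating first in [w]
      gives [Gamma(a) Gamma(b)], integrating first in [t] gives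
      [Gamma(a+b) int_0^oo w^(b-1) (1+w)^(-(a+b)) dw].  The substitution
      [t = x w / (1 + w)] turns the last integral into the one over ]0, x[.

    - The recursion [Gamma(z+1) = z Gamma(z)] ([gamma_rec]) holds because
      [t^z e^(-t)] vanishes at both ends of the half line.  It makes
      [1 / |Gamma(w + n)|] eventually nonincreasing in n, hence bounded
      ([Gamma_inv_bounded]); this is the constant [M] above.

    - Dividing by [Gamma(a+s)] and by [Gamma(a)] is legitimate because the Gamma
      integral has no zero ([gamma_neq0]).  If [Gamma(z) = 0], then
      [Gamma(z/2)^2 = Gamma(z) B(z/2, z/2) = 0], so that Gamma vanishes at every
      [z/2^n] and, by the recursion, at every [1 + z/2^n]; by continuity it
      vanishes at 1, but [Gamma(1)] is the integral of a positive function. *)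

(** * Complex powers of positive reals *)

Section cpow_algebra.
Variable R : realType.
Implicit Types (x y t : R) (s z w : R[i]).

Lemma ReM z w : complex.Re (z * w) =
  complex.Re z * complex.Re w - complex.Im z * complex.Im w.
Proof. by case: z w => [a b] [c d]. Qed.

Lemma ImM z w : complex.Im (z * w) =
  complex.Re z * complex.Im w + complex.Im z * complex.Re w.
Proof. by case: z w => [a b] [c d]. Qed.

Lemma ReD z w : complex.Re (z + w) = complex.Re z + complex.Re w.
Proof. by case: z w => [a b] [c d]. Qed.

Lemma ImD z w : complex.Im (z + w) = complex.Im z + complex.Im w.
Proof. by case: z w => [a b] [c d]. Qed.

Lemma ReN z : complex.Re (- z) = - complex.Re z.
Proof. by case: z. Qed.

Lemma ImN z : complex.Im (- z) = - complex.Im z.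
Proof. by case: z. Qed.

Lemma natrC n : n%:R = (n%:R)%:C :> R[i].
Proof. by rewrite rmorph_nat. Qed.

Lemma Re_divr z x : complex.Re (z / x%:C) = complex.Re z / x.
Proof. by rewrite -fmorphV ReM /= mulr0 subr0. Qed.

Lemma complexP z w : complex.Re z = complex.Re w ->
  complex.Im z = complex.Im w -> z = w.
Proof. by case: z w => [a b] [c d] /= -> ->. Qed.

Lemma normc_ge0 z : 0 <= normc z.
Proof. by case: z => a b; exact: sqrtr_ge0. Qed.

Lemma normc_eq0 z : (normc z == 0) = (z == 0).
Proof. by apply/eqP/eqP => [/eq0_normc//|->]; rewrite normc0. Qed.

Lemma normc_real x : normc x%:C = `|x|.
Proof. by rewrite /= expr0n/= addr0 sqrtr_sqr. Qed.

Lemma normc_geRe z : `|complex.Re z| <= normc z.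
Proof.
case: z => a b /=; rewrite -sqrtr_sqr ler_sqrt ?lerDl ?sqr_ge0//.
by rewrite addr_ge0 ?sqr_ge0.
Qed.

Lemma normc_geIm z : `|complex.Im z| <= normc z.
Proof.
case: z => a b /=; rewrite -sqrtr_sqr ler_sqrt ?lerDr ?sqr_ge0//.
by rewrite addr_ge0 ?sqr_ge0.
Qed.

Lemma normc_le_ReIm z : normc z <= `|complex.Re z| + `|complex.Im z|.
Proof.
case: z => a b /=; rewrite -[leRHS]ger0_norm ?addr_ge0// -sqrtr_sqr.
rewrite ler_sqrt ?sqr_ge0// sqrrD !real_normK ?num_real//.
by rewrite -addrA lerD2l lerDr mulrn_wge0// mulr_ge0.
Qed.

Lemma cexpD z w : cexp (z + w) = cexp z * cexp w.
Proof.
apply: complexP; rewrite /cexp !(ReM, ImM, ReD, ImD)/= ?expRD ?cosD ?sinD; ring.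
Qed.

Lemma cexp_real x : cexp x%:C = (expR x)%:C.
Proof. by rewrite /cexp /= cos0 sin0 mulr1. Qed.

Lemma cexp0 : cexp (0 : R[i]) = 1.
Proof. by rewrite (cexp_real 0) expR0. Qed.

Lemma normc_cexp z : normc (cexp z) = expR (complex.Re z).
Proof.
rewrite /cexp normcM normc_real ger0_norm ?expR_ge0//=.
by rewrite cos2Dsin2 sqrtr1 mulr1.
Qed.

Lemma Re_cexp z :
  complex.Re (cexp z) = expR (complex.Re z) * cos (complex.Im z).
Proof. by rewrite /cexp ReM /= mul0r subr0. Qed.

Lemma Im_cexp z :
  complex.Im (cexp z) = expR (complex.Re z) * sin (complex.Im z).
Proof. by rewrite /cexp ImM /= mul0r addr0. Qed.

Lemma Re_cpow y s : complex.Re (cpow y s) =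
  expR (complex.Re s * ln y) * cos (complex.Im s * ln y).
Proof. by rewrite Re_cexp ReM ImM /= !mulr0 subr0 add0r. Qed.

Lemma Im_cpow y s : complex.Im (cpow y s) =
  expR (complex.Re s * ln y) * sin (complex.Im s * ln y).
Proof. by rewrite Im_cexp ReM ImM /= !mulr0 subr0 add0r. Qed.

Lemma cpowD y s z : cpow y (s + z) = cpow y s * cpow y z.
Proof. by rewrite /cpow mulrDl cexpD. Qed.

Lemma cpow0 y : cpow y 0 = 1.
Proof. by rewrite /cpow mul0r cexp0. Qed.

Lemma cpow1l s : cpow 1 s = 1.
Proof. by rewrite /cpow ln1 mulr0 cexp0. Qed.

Lemma cpow_neq0 y s : cpow y s != 0.
Proof. by rewrite -normc_eq0 normc_cexp gt_eqF ?expR_gt0. Qed.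

Lemma cpowN y s : cpow y (- s) = (cpow y s)^-1.
Proof.
apply: (mulfI (cpow_neq0 y s)).
by rewrite -cpowD subrr cpow0 divff ?cpow_neq0.
Qed.

Lemma cpowB y s z : cpow y (s - z) = cpow y s / cpow y z.
Proof. by rewrite cpowD cpowN. Qed.

Lemma cpowM x y s : 0 < x -> 0 < y -> cpow (x * y) s = cpow x s * cpow y s.
Proof.
by move=> x0 y0; rewrite /cpow lnM ?posrE// rmorphD mulrDr cexpD.
Qed.

Lemma cpowV x s : 0 < x -> cpow x^-1 s = (cpow x s)^-1.
Proof.
move=> x0; apply: (mulfI (cpow_neq0 x s)).
by rewrite -cpowM ?invr_gt0// divff ?gt_eqF// cpow1l divff ?cpow_neq0.
Qed.

Lemma cpow_div x y s : 0 < x -> 0 < y -> cpow (x / y) s = cpow x s / cpow y s.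
Proof. by move=> x0 y0; rewrite cpowM ?invr_gt0// cpowV. Qed.

Lemma cpow_real y x : 0 < y -> cpow y x%:C = (y `^ x)%:C.
Proof.
by move=> y0; rewrite /cpow -rmorphM cexp_real /powR gt_eqF.
Qed.

Lemma cpow_nat y n : 0 < y -> cpow y n%:R = (y ^+ n)%:C.
Proof. by move=> y0; rewrite natrC cpow_real// powR_mulrn// ltW. Qed.

Lemma cpow1 y : 0 < y -> cpow y 1 = y%:C.
Proof. by move=> y0; rewrite (cpow_nat 1). Qed.

Lemma cpow_powR y x s : 0 < y -> cpow (y `^ x) s = cpow y (x%:C * s).
Proof.
by move=> y0; rewrite /cpow ln_powR rmorphM; congr cexp; ring.
Qed.

Lemma normc_cpow y s : 0 < y -> normc (cpow y s) = y `^ complex.Re s.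
Proof.
by move=> y0; rewrite normc_cexp ReM /= mulr0 subr0 /powR gt_eqF.
Qed.

Lemma normc_cpowM y s z : 0 < y ->
  normc (cpow y s * z) = y `^ complex.Re s * normc z.
Proof. by move=> y0; rewrite normcM normc_cpow. Qed.

End cpow_algebra.

(** * Limits and series of complex numbers *)

Section complex_limits.
Variable R : realType.
Implicit Types (u v : nat -> R[i]) (l c : R[i]).

(** Convergence is expressed on the real and imaginary parts, so that the
    limit theorems for real sequences and real integrals apply; [ccvg_cvg] links
    it to the topology of the modulus. *)
Definition ccvg u l : Prop :=
  (complex.Re (u n) @[n --> \oo] --> complex.Re l) /\
  (complex.Im (u n) @[n --> \oo] --> complex.Im l).

Lemma ccvg_unique u l l' : ccvg u l -> ccvg u l' -> l = l'.
Proof.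
move=> [ul1 ul2] [ul1' ul2']; apply: complexP.
- exact: (cvg_unique _ ul1 ul1').
- exact: (cvg_unique _ ul2 ul2').
Qed.

Lemma ccvg_cvg u l : ccvg u l -> (u : nat -> R[i]^o) @ \oo --> (l : R[i]^o).
Proof.
move=> [uRe uIm]; apply/cvgrPdist_lt => /= e.
rewrite ltcE /= => /andP[/eqP eIm eRe].
have e2 : 0 < complex.Re e / 2 by rewrite divr_gt0.
move/cvgrPdist_lt : uRe => /(_ _ e2) uRe.
move/cvgrPdist_lt : uIm => /(_ _ e2) uIm.
near=> n.
have -> : e = (complex.Re e)%:C by apply: complexP => //=; rewrite eIm.
change ((normc (l - u n))%:C < (complex.Re e)%:C).
rewrite ltcR (le_lt_trans (normc_le_ReIm _))// ReD ImD ReN ImN.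
by rewrite [ltRHS]splitr ltrD//; near: n.
Unshelve. all: by end_near. Qed.

Lemma ccvgZ c u l : ccvg u l -> ccvg (fun n => c * u n) (c * l).
Proof.
move=> [uRe uIm]; split.
- under eq_fun do rewrite ReM.
  by rewrite ReM; apply: cvgB; apply: cvgMr.
- under eq_fun do rewrite ImM.
  by rewrite ImM; apply: cvgD; apply: cvgMr.
Qed.

Lemma Re_series u n :
  complex.Re (series u n) = series (fun k => complex.Re (u k)) n.
Proof.
rewrite /series /=; elim: n => [|n IH]; first by rewrite !big_nil.
by rewrite !big_nat_recr//= ReD IH.
Qed.

Lemma Im_series u n :
  complex.Im (series u n) = series (fun k => complex.Im (u k)) n.
Proof.
rewrite /series /=; elim: n => [|n IH]; first by rewrite !big_nil.
by rewrite !big_nat_recr//= ImD IH.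
Qed.

Lemma normc_series u n : normc (series u n) <= series (fun k => normc (u k)) n.
Proof.
rewrite /series /=; elim: n => [|n IH]; first by rewrite !big_nil normc0.
by rewrite !big_nat_recr//= (le_trans (le_normcD _ _))// lerD2r.
Qed.

Lemma ccvg_csum u l : ccvg (series u) l -> csummable u /\ csum u = l.
Proof.
move=> /ccvg_cvg ul; split; first by apply/cvg_ex; exists l.
exact: (cvg_lim _ ul).
Qed.

(** Absolute convergence, through the comparison test on both parts. *)
Lemma ccvg_series_dom u (C : nat -> R) :
  (forall n, normc (u n) <= C n) -> cvgn (series C) ->
  ccvg (series u) (csum u).
Proof.
move=> uC cvgC.
have dom (w : nat -> R) : (forall n, `|w n| <= C n) -> cvgn (series w).
  move=> wC; apply: normed_cvg; apply: (series_le_cvg _ _ wC) => // n.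
  exact: le_trans (normr_ge0 _) (wC n).
have cRe : cvgn (series (fun k => complex.Re (u k))).
  by apply: dom => n; exact: le_trans (normc_geRe _) (uC n).
have cIm : cvgn (series (fun k => complex.Im (u k))).
  by apply: dom => n; exact: le_trans (normc_geIm _) (uC n).
pose l := limn (series (fun k => complex.Re (u k))) +i*
          limn (series (fun k => complex.Im (u k))).
have ul : ccvg (series u) l.
  split.
  - by under eq_fun do rewrite Re_series.
  - by under eq_fun do rewrite Im_series.
by have [_ ->] := ccvg_csum ul.
Qed.

Lemma ccvg_seriesZ c u l : ccvg (series u) l ->
  ccvg (series (fun n => c * u n)) (c * l).
Proof.
move=> /(ccvgZ c); rewrite (_ : (fun n => _) = series (fun n => c * u n))//.
by apply/funext => n; rewrite /series/= mulr_sumr.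
Qed.

End complex_limits.

(** * Measurability and integration of complex functions *)

Section complex_measurable.
Context d (T : measurableType d) (R : realType).
Implicit Types (D : set T) (f g : T -> R[i]).

Definition cmeasurable D f : Prop :=
  measurable_fun D (fun t => complex.Re (f t)) /\
  measurable_fun D (fun t => complex.Im (f t)).

Lemma cmeasurable_cst D (c : R[i]) : cmeasurable D (fun=> c).
Proof. by split; exact: measurable_cst. Qed.

Lemma cmeasurable_real D (g : T -> R) :
  measurable_fun D g -> cmeasurable D (fun t => (g t)%:C).
Proof. by move=> mg; split => //=; exact: measurable_cst. Qed.

Lemma cmeasurableM D f g :
  cmeasurable D f -> cmeasurable D g -> cmeasurable D (fun t => f t * g t).
Proof.
move=> [f1 f2] [g1 g2]; split.
- by under eq_fun do rewrite ReM; apply: measurable_funB; exact: measurable_funM.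
- by under eq_fun do rewrite ImM; apply: measurable_funD; exact: measurable_funM.
Qed.

Lemma cmeasurable_cpow D (g : T -> R) (s : R[i]) :
  measurable_fun D g -> cmeasurable D (fun t => cpow (g t) s).
Proof.
move=> mg.
have mln : measurable_fun D (fun t => ln (g t)).
  exact: (measurableT_comp (@measurable_ln R) mg).
have mE : measurable_fun D (fun t => expR (complex.Re s * ln (g t))).
  by apply: (measurableT_comp (@measurable_expR R)); exact: measurable_funM.
have mI : measurable_fun D (fun t => complex.Im s * ln (g t)).
  exact: measurable_funM.
split.
- under eq_fun do rewrite Re_cpow.
  apply: measurable_funM => //; apply: (measurableT_comp _ mI).
  exact: continuous_measurable_fun (@continuous_cos R).
- under eq_fun do rewrite Im_cpow.
  apply: measurable_funM => //; apply: (measurableT_comp _ mI).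
  exact: continuous_measurable_fun (@continuous_sin R).
Qed.

End complex_measurable.

Section complex_integral.
Variable R : realType.
Local Notation mu := (@lebesgue_measure R).
Implicit Types (D : set (measurableTypeR R)) (f g : R -> R[i]) (c : R[i]).

Lemma eq_cintegrable D f g : measurable D -> (forall t, D t -> f t = g t) ->
  cintegrable D f -> cintegrable D g.
Proof.
move=> mD fg [f1 f2]; split.
- by apply: eq_integrable f1 => // t /set_mem Dt; rewrite fg.
- by apply: eq_integrable f2 => // t /set_mem Dt; rewrite fg.
Qed.

Lemma eq_cintegral D f g : (forall t, D t -> f t = g t) ->
  cintegral D f = cintegral D g.
Proof.
by move=> fg; congr (_ +i* _); apply: eq_Rintegral => t /set_mem Dt; rewrite fg.
Qed.

Lemma cintegrable_measurable D f :
  cintegrable D f -> cmeasurable D f.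
Proof.
by move=> [f1 f2]; split; [move: f1|move: f2] => /measurable_int/measurable_EFinP.
Qed.

(** The main criterion for integrability: the complex functions below are
    compared with the corresponding functions of the real parts of their
    parameters. *)
Lemma cintegrable_dom D f (g : R -> R) : measurable D -> cmeasurable D f ->
  mu.-integrable D (EFin \o g) -> (forall t, D t -> normc (f t) <= g t) ->
  cintegrable D f.
Proof.
move=> mD [f1 f2] ig fg; split.
- apply: le_integrable ig => //; first exact/measurable_EFinP.
  move=> t Dt /=; rewrite lee_fin (le_trans (normc_geRe _))//.
  by rewrite (le_trans (fg _ Dt))// ler_norm.
- apply: le_integrable ig => //; first exact/measurable_EFinP.
  move=> t Dt /=; rewrite lee_fin (le_trans (normc_geIm _))//.
  by rewrite (le_trans (fg _ Dt))// ler_norm.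
Qed.

Lemma cintegralZ D c f : measurable D -> cintegrable D f ->
  cintegrable D (fun t => c * f t) /\
  cintegral D (fun t => c * f t) = c * cintegral D f.
Proof.
move=> mD [f1 f2].
have h (a : R) (k : R -> R) : mu.-integrable D (EFin \o k) ->
    mu.-integrable D (EFin \o (fun t => a * k t)).
  by move=> ik; have := integrableZl mD a ik; apply: eq_integrable.
split; first split.
- rewrite [X in _.-integrable _ X](_ : _ =
    ((fun t => (complex.Re c * complex.Re (f t))%:E) \-
     (fun t => (complex.Im c * complex.Im (f t))%:E))%E).
    by apply: integrableB => //; exact: h.
  by apply/funext => t /=; rewrite ReM EFinB.
- rewrite [X in _.-integrable _ X](_ : _ =
    ((fun t => (complex.Re c * complex.Im (f t))%:E) \+
     (fun t => (complex.Im c * complex.Re (f t))%:E))%E).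
    by apply: integrableD => //; exact: h.
  by apply/funext => t /=; rewrite ImM EFinD.
apply: complexP; rewrite ?ReM ?ImM /=.
- under eq_Rintegral do rewrite ReM.
  by rewrite RintegralB ?RintegralZl//; exact: h.
- under eq_Rintegral do rewrite ImM.
  by rewrite RintegralD ?RintegralZl//; exact: h.
Qed.

Lemma cintegralD D f g : measurable D -> cintegrable D f -> cintegrable D g ->
  cintegrable D (fun t => f t + g t) /\
  cintegral D (fun t => f t + g t) = cintegral D f + cintegral D g.
Proof.
move=> mD [f1 f2] [g1 g2]; split; first split.
- apply: eq_integrable (integrableD mD f1 g1) => // t _ /=.
  by rewrite ReD EFinD.
- apply: eq_integrable (integrableD mD f2 g2) => // t _ /=.
  by rewrite ImD EFinD.
apply: complexP; rewrite ?ReD ?ImD /=.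
- by under eq_Rintegral do rewrite ReD; rewrite RintegralD.
- by under eq_Rintegral do rewrite ImD; rewrite RintegralD.
Qed.

Lemma cintegral_real D (g : R -> R) :
  cintegral D (fun t => (g t)%:C) = (Rintegral mu D g)%:C.
Proof. by apply: complexP => //=; rewrite /Rintegral integral0. Qed.

Lemma Rdominated_convergence D (f_ : nat -> R -> R) (f g : R -> R) :
  measurable D -> (forall n, measurable_fun D (f_ n)) ->
  (forall t, D t -> f_ n t @[n --> \oo] --> f t) ->
  mu.-integrable D (EFin \o g) ->
  (forall n t, D t -> `|f_ n t| <= g t) ->
  mu.-integrable D (EFin \o f) /\
  Rintegral mu D (f_ n) @[n --> \oo] --> Rintegral mu D f.
Proof.
move=> mD mf_ f_f ig f_g.
have mf : measurable_fun D f by exact: (measurable_fun_cvg mf_ f_f).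
have [| | | | |intf _ cvgf] := @dominated_convergence _ _ _ mu D mD
    (fun n => EFin \o f_ n) (EFin \o f) (EFin \o g).
- by move=> n; exact/measurable_EFinP.
- exact/measurable_EFinP.
- apply: aeW => t Dt; apply: cvg_EFin; last exact: f_f.
  by apply: nearW.
- exact: ig.
- by apply: aeW => t Dt n; rewrite lee_fin f_g.
split => //.
have fin_f : (\int[mu]_(x in D) (f x)%:E)%E \is a fin_num.
  exact: integrable_fin_num.
move: cvgf; rewrite -(fineK fin_f) => /fine_cvgP[_].
exact.
Qed.

Lemma cdominated_convergence D (f_ : nat -> R -> R[i]) f (g : R -> R) :
  measurable D -> (forall n, cmeasurable D (f_ n)) ->
  (forall t, D t -> ccvg (f_^~ t) (f t)) ->
  mu.-integrable D (EFin \o g) ->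
  (forall n t, D t -> normc (f_ n t) <= g t) ->
  cintegrable D f /\ ccvg (fun n => cintegral D (f_ n)) (cintegral D f).
Proof.
move=> mD mf_ f_f ig f_g.
have [] := @Rdominated_convergence D (fun n t => complex.Re (f_ n t))
  (fun t => complex.Re (f t)) g mD (fun n => (mf_ n).1)
  (fun t Dt => (f_f t Dt).1) ig.
  by move=> n t Dt; exact: le_trans (normc_geRe _) (f_g _ _ Dt).
have [] := @Rdominated_convergence D (fun n t => complex.Im (f_ n t))
  (fun t => complex.Im (f t)) g mD (fun n => (mf_ n).2)
  (fun t Dt => (f_f t Dt).2) ig.
  by move=> n t Dt; exact: le_trans (normc_geIm _) (f_g _ _ Dt).
by move=> ? ? ? ?; split; split.
Qed.

Lemma series_dom_le (C : nat -> R) n : (forall k, 0 <= C k) ->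
  cvgn (series C) -> series C n <= limn (series C).
Proof.
move=> C0 cC; apply: nondecreasing_cvgn_le => //.
exact: nondecreasing_series.
Qed.

(** The partial sums are dominated by [g] times the sum of the [C n], so
    dominated convergence allows integrating term by term. *)
Lemma cintegral_series D (f : nat -> R -> R[i]) (C : nat -> R) (g : R -> R) :
  measurable D -> (forall n, cmeasurable D (f n)) ->
  mu.-integrable D (EFin \o g) ->
  (forall t, D t -> 0 <= g t) -> (forall n, 0 <= C n) -> cvgn (series C) ->
  (forall n t, D t -> normc (f n t) <= C n * g t) ->
  cintegrable D (fun t => csum (f^~ t)) /\
  ccvg (series (fun n => cintegral D (f n)))
       (cintegral D (fun t => csum (f^~ t))).
Proof.
move=> mD mf ig g0 C0 cC fCg.
have intf n : cintegrable D (f n).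
  apply: (@cintegrable_dom _ _ (fun t => C n * g t)) => //.
    by apply: eq_integrable (integrableZl mD (C n) ig).
  exact: fCg.
have serE n : cintegrable D (fun t => series (f^~ t) n) /\
    cintegral D (fun t => series (f^~ t) n) =
    series (fun k => cintegral D (f k)) n.
  elim: n => [|n [IH1 IH2]].
    have E t : series (f^~ t) 0%N = 0 by rewrite /series/= big_nil.
    split.
      apply: (@eq_cintegrable _ (fun=> 0) _ mD) => [t _|]; first by rewrite E.
      by split; exact: integrable0.
    rewrite (eq_cintegral (fun t _ => E t)) /series/= big_nil.
    by apply: complexP => /=; rewrite /Rintegral integral0.
  have E t : series (f^~ t) n.+1 = series (f^~ t) n + f n t.
    by rewrite /series/= big_nat_recr.
  have [I1 I2] := cintegralD mD IH1 (intf n).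
  split; first by apply: eq_cintegrable I1 => // t _; rewrite E.
  rewrite (eq_cintegral (fun t _ => E t)) I2 IH2.
  by rewrite /series/= big_nat_recr.
have [] := @cdominated_convergence D (fun n t => series (f^~ t) n)
  (fun t => csum (f^~ t)) (fun t => limn (series C) * g t) mD.
- by move=> n; exact: cintegrable_measurable (serE n).1.
- move=> t Dt; apply: (@ccvg_series_dom _ _ (fun n => g t * C n)).
    by move=> n; rewrite mulrC; exact: fCg.
  exact: is_cvg_seriesZ.
- by apply: eq_integrable (integrableZl mD (limn (series C)) ig).
- move=> n t Dt; apply: (le_trans (normc_series _ _)).
  apply: (@le_trans _ _ (series C n * g t)).
    by rewrite /series/= mulr_suml; apply: ler_sum => k _; exact: fCg.
  by rewrite ler_wpM2r ?g0// series_dom_le.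
move=> cf cvgf; split => //.
rewrite (_ : series _ = fun n => cintegral D (fun t => series (f^~ t) n))//.
by apply/funext => n; rewrite (serE n).2.
Qed.

End complex_integral.

(** * Change of variables from the half line *)

Section substitution.
Variable R : realType.
Local Notation mu := (@lebesgue_measure R).
Local Notation pos := (`]0%R, +oo[%classic : set (measurableTypeR R)).

Lemma exhaustion_pos (t : R) : 0 < t ->
  exists n : nat, n.+1%:R^-1 <= t <= n.+1%:R.
Proof.
move=> t0; pose n := Num.truncn (t + t^-1).
have tV0 : 0 < t^-1 by rewrite invr_gt0.
have tn : t + t^-1 < n.+1%:R by rewrite truncnS_gt.
exists n; apply/andP; split.
- by rewrite invf_ple ?posrE// ltW// (lt_trans _ tn)// ltrDr.
- by rewrite ltW// (lt_trans _ tn)// ltrDl.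
Qed.

Lemma exhaustion_nd m n : (m <= n)%N ->
  (n.+1%:R^-1 <= m.+1%:R^-1 :> R) && (m.+1%:R <= n.+1%:R :> R).
Proof. by move=> mn; rewrite lef_pV2 ?posrE// !ler_nat !ltnS mn. Qed.

(** The changes of variable below all have the half line as their source, and
    one exhaustion by the intervals [1/(n+1), n+1] serves for all of them.  The
    derivative [f] is part of the data because it appears in the integrals. *)
Record increasing_onto (J : set R) (F f : R -> R) : Prop := IncreasingOnto {
  onto_in : forall t : R, 0 < t -> J (F t);
  onto_surj : forall y, J y -> exists2 t : R, 0 < t & F t = y;
  onto_incr : forall s t : R, 0 < s -> s < t -> F s < F t;
  onto_deriv : forall t : R, 0 < t -> is_derive t 1 F (f t);
  onto_ge0 : forall t : R, 0 < t -> 0 <= f t;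
  onto_cont : forall t : R, 0 < t -> {for t, continuous f} }.

Section real_substitution.
Variables (J : set R) (F f : R -> R).
Hypothesis hF : increasing_onto J F f.

Let cvgF (t : R) : 0 < t -> {for t, continuous F}.
Proof.
move=> t0; have [dF _] := onto_deriv hF t0.
exact/differentiable_continuous/derivable1_diffP.
Qed.

Let derF (t : R) : 0 < t -> derive1 F t = f t.
Proof. by move=> t0; rewrite derive1E; have := onto_deriv hF t0 => -[]. Qed.

Let cderF (t : R) : 0 < t -> derive1 F x @[x --> t] --> derive1 F t.
Proof.
move=> t0; rewrite derF//.
apply: cvg_trans (onto_cont hF t0); apply: near_eq_cvg.
near=> x; rewrite derF//; near: x.
exact: lt_nbhsr.
Unshelve. all: by end_near. Qed.

Let oP n : 0 < n.+1%:R^-1 :> R. Proof. by rewrite invr_gt0. Qed.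

Let le_oP n : n.+1%:R^-1 <= n.+1%:R :> R.
Proof. by rewrite (@le_trans _ _ 1)// ?invf_le1// ler1n. Qed.

Let homF (s t : R) : 0 < s -> s <= t -> F s <= F t.
Proof.
move=> s0; rewrite le_eqVlt => /predU1P[->//|st].
exact/ltW/(onto_incr hF).
Qed.

Let EJ n y : F n.+1%:R^-1 <= y <= F n.+1%:R -> J y.
Proof.
move=> /andP[y1 y2].
have cF : {within `[n.+1%:R^-1, n.+1%:R], continuous F}.
  apply: continuous_in_subspaceT => t /set_mem /=; rewrite in_itv/= => /andP[t1 _].
  exact/cvgF/(lt_le_trans (oP n) t1).
have [|t] := IVT (v := y) (le_oP n) cF.
  by rewrite ge_min y1/= le_max y2 orbT.
rewrite in_itv/= => /andP[t1 _] <-; apply: (onto_in hF).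
exact: lt_le_trans (oP n) t1.
Qed.

(** On each interval [1/(n+1), n+1] everything is continuous up to the
    boundary and the usual theorem applies; for a nonnegative function both sides
    then increase to the integrals over the open sets.  Singularities of [G] at
    the ends of [J], and of [f] at 0 and at infinity, are thus harmless. *)
Lemma ge0_substitution (G : R -> R) :
  (forall y, J y -> 0 <= G y) ->
  (forall y, J y -> {for y, continuous G}) ->
  (\int[mu]_(y in J) (G y)%:E = \int[mu]_(t in pos) (G (F t) * f t)%:E)%E.
Proof.
move=> G0 cG.
pose I n : set (measurableTypeR R) := `[n.+1%:R^-1, n.+1%:R]%classic.
pose K n : set (measurableTypeR R) := `[F n.+1%:R^-1, F n.+1%:R]%classic.
have UI : \bigcup_n I n = pos.
  apply/seteqP; split=> [t [n _]|t] /=; rewrite !in_itv/= ?andbT.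
    by move=> /andP[tn _]; exact: lt_le_trans (oP n) tn.
  by move=> /exhaustion_pos[n tn]; exists n => //=; rewrite /I/= in_itv/=.
have UK : \bigcup_n K n = J.
  apply/seteqP; split=> [y [n _]|y Jy] /=.
    by rewrite /K /= in_itv/=; exact: EJ.
  have [t t0 <-] := onto_surj hF Jy; have [n /andP[n1 n2]] := exhaustion_pos t0.
  by exists n => //; rewrite /K/= in_itv/= !homF.
have ndI : nondecreasing_seq I.
  move=> m n mn; apply/subsetPset => t; rewrite /I /= !in_itv/= => /andP[t1 t2].
  have /andP[h1 h2] := exhaustion_nd mn.
  by rewrite (le_trans h1 t1) (le_trans t2 h2).
have ndK : nondecreasing_seq K.
  move=> m n mn; apply/subsetPset => t; rewrite /K /= !in_itv/= => /andP[t1 t2].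
  have /andP[h1 h2] := exhaustion_nd mn.
  by rewrite (le_trans (homF _ h1) t1)// (le_trans t2 (homF _ h2)).
have cGK n : {within K n, continuous G}.
  apply: continuous_in_subspaceT => y /set_mem; rewrite /K/= in_itv/= => yK.
  exact/cG/(EJ yK).
have cGI n : {within I n, continuous (fun t => G (F t) * f t)}.
  apply: continuous_in_subspaceT => t /set_mem; rewrite /I/= in_itv/= => /andP[t1 _].
  have t0 : 0 < t by exact: lt_le_trans (oP n) t1.
  apply: continuousM; last exact: (onto_cont hF).
  apply: continuous_comp; first exact: cvgF.
  exact/cG/(onto_in hF).
have E n : (\int[mu]_(y in K n) (G y)%:E =
            \int[mu]_(t in I n) (G (F t) * f t)%:E)%E.
  rewrite integration_by_substitution_increasing//.
  - apply: eq_integral => t /set_mem; rewrite /I/= in_itv/= => /andP[t1 _].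
    by rewrite -(derF (lt_le_trans (oP n) t1)).
  - move=> s t; rewrite !in_itv/= => /andP[s1 _] _; apply: (onto_incr hF).
    exact: lt_le_trans (oP n) s1.
  - move=> t; rewrite in_itv/= => /andP[t1 _]; apply: cderF.
    exact: lt_trans (oP n) t1.
  - by apply/cvg_ex; exists (derive1 F n.+1%:R^-1); apply: cvg_at_right_filter;
      exact: cderF.
  - by apply/cvg_ex; exists (derive1 F n.+1%:R); apply: cvg_at_left_filter;
      exact: cderF.
  - split.
    + move=> t; rewrite in_itv/= => /andP[t1 _].
      by have [] := onto_deriv hF (lt_trans (oP n) t1).
    + by apply: cvg_at_right_filter; exact: cvgF.
    + by apply: cvg_at_left_filter; exact: cvgF.
  - exact: cGK.
have cvgK : (\int[mu]_(y in K n) (G y)%:E @[n --> \oo] -->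
             \int[mu]_(y in J) (G y)%:E)%E.
  rewrite -UK; apply: ge0_nondecreasing_set_cvg_integral => //.
  - by move=> i; exact: measurable_itv.
  - move=> i; apply/measurable_EFinP; apply: subspace_continuous_measurable_fun;
      [exact: measurable_itv|exact: cGK].
  - by move=> i y Ky; rewrite lee_fin G0// -UK; exists i.
have cvgI : (\int[mu]_(t in I n) (G (F t) * f t)%:E @[n --> \oo] -->
             \int[mu]_(t in pos) (G (F t) * f t)%:E)%E.
  rewrite -UI; apply: ge0_nondecreasing_set_cvg_integral => //.
  - by move=> i; exact: measurable_itv.
  - move=> i; apply/measurable_EFinP; apply: subspace_continuous_measurable_fun;
      [exact: measurable_itv|exact: cGI].
  - move=> i t It; have : pos t by rewrite -UI; exists i.
    rewrite /= in_itv/= andbT => t0; rewrite lee_fin mulr_ge0 ?(onto_ge0 hF)//.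
    exact/G0/(onto_in hF).
rewrite -(cvg_lim _ cvgK)// -(cvg_lim _ cvgI)//.
by congr (limn _); apply/funext => i; exact: E.
Qed.

(** Both sides are defined as the integral of the positive part minus that of
    the negative part, and [f >= 0] lets the factor pass through the parts. *)
Lemma substitution (G : R -> R) :
  (forall y, J y -> {for y, continuous G}) ->
  (\int[mu]_(y in J) (G y)%:E = \int[mu]_(t in pos) (G (F t) * f t)%:E)%E.
Proof.
move=> cG; rewrite [LHS]integralE [RHS]integralE.
have max0 (H : R -> R) : (forall y, J y -> {for y, continuous H}) ->
  (\int[mu]_(y in J) (Num.max (H y) 0)%:E =
   \int[mu]_(t in pos) (Num.max (H (F t) * f t) 0)%:E)%E.
  move=> cH; rewrite (@ge0_substitution (fun y => Num.max (H y) 0)).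
  - apply: eq_integral => t /set_mem; rewrite /= in_itv/= andbT => t0.
    by rewrite maxr_pMl ?(onto_ge0 hF)// mul0r.
  - by move=> y _; rewrite le_max lexx orbT.
  - move=> y Jy; apply: (@continuous_max R R H (cst 0)); first exact: cH.
    exact: cst_continuous.
congr (_ - _)%E.
- under eq_integral do rewrite funeposE -EFin_max.
  by under [in RHS]eq_integral do rewrite funeposE -EFin_max; exact: max0.
- under eq_integral do rewrite funenegE -EFinN -EFin_max.
  under [in RHS]eq_integral do rewrite funenegE -EFinN -EFin_max -mulNr.
  apply: (max0 (fun y => - G y)) => y Jy.
  exact/continuousN/cG.
Qed.

Lemma integrable_substitution (G : R -> R) : open J ->
  (forall y, J y -> {for y, continuous G}) ->
  mu.-integrable J (EFin \o G) <->
  mu.-integrable pos (EFin \o (fun t => G (F t) * f t)).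
Proof.
move=> oJ cG.
have mG : measurable_fun J G.
  by apply: open_continuous_measurable_fun => // y /set_mem; exact: cG.
have mGF : measurable_fun pos (fun t => G (F t) * f t).
  apply: open_continuous_measurable_fun; first exact: interval_open.
  move=> t /set_mem /=; rewrite in_itv/= andbT => t0.
  apply: continuousM; last exact: (onto_cont hF).
  apply: continuous_comp; first exact: cvgF.
  exact/cG/(onto_in hF).
have E : (\int[mu]_(y in J) `|(G y)%:E| =
          \int[mu]_(t in pos) `|(G (F t) * f t)%:E|)%E.
  rewrite (@ge0_substitution (fun y => `|G y|)) => //.
    apply: eq_integral => t /set_mem; rewrite /= in_itv/= andbT => t0.
    by rewrite normrM (ger0_norm (onto_ge0 hF t0)).
  move=> y Jy; apply: continuous_comp; first exact: cG.
  exact: norm_continuous.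
by split => /integrableP[_ h]; apply/integrableP; split;
  [exact/measurable_EFinP|rewrite -E|exact/measurable_EFinP|rewrite E].
Qed.

End real_substitution.

Definition ccontinuous (J : set R) (g : R -> R[i]) : Prop := forall y, J y ->
  {for y, continuous (fun t => complex.Re (g t))} /\
  {for y, continuous (fun t => complex.Im (g t))}.

Lemma csubstitution (J : set R) (F f : R -> R) (G : R -> R[i]) :
  increasing_onto J F f -> open J -> ccontinuous J G ->
  (cintegrable J G <-> cintegrable pos (fun t => G (F t) * (f t)%:C)) /\
  cintegral J G = cintegral pos (fun t => G (F t) * (f t)%:C).
Proof.
move=> hF oJ cG.
have ReE t : complex.Re (G (F t) * (f t)%:C) = complex.Re (G (F t)) * f t.
  by rewrite ReM /= mulr0 subr0.
have ImE t : complex.Im (G (F t) * (f t)%:C) = complex.Im (G (F t)) * f t.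
  by rewrite ImM /= mulr0 add0r.
have cRe y : J y -> {for y, continuous (fun t => complex.Re (G t))}.
  by move=> /cG[].
have cIm y : J y -> {for y, continuous (fun t => complex.Im (G t))}.
  by move=> /cG[].
split.
- have hRe := integrable_substitution hF oJ cRe.
  have hIm := integrable_substitution hF oJ cIm.
  rewrite /cintegrable.
  have -> : (fun t => (complex.Re (G (F t) * (f t)%:C))%:E) =
      EFin \o (fun t => complex.Re (G (F t)) * f t).
    by apply/funext => t; rewrite ReE.
  have -> : (fun t => (complex.Im (G (F t) * (f t)%:C))%:E) =
      EFin \o (fun t => complex.Im (G (F t)) * f t).
    by apply/funext => t; rewrite ImE.
  by split => -[/hRe ? /hIm ?].
- rewrite /cintegral /Rintegral; congr (_ +i* _); congr fine.
  + by under [RHS]eq_integral do rewrite ReE; exact: substitution.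
  + by under [RHS]eq_integral do rewrite ImE; exact: substitution.
Qed.

End substitution.

(** * Continuity of complex functions *)

Section continuity.
Variable R : realType.
Implicit Types (J : set R) (g h : R -> R[i]).

Lemma ccontinuousM J g h : ccontinuous J g -> ccontinuous J h ->
  ccontinuous J (fun t => g t * h t).
Proof.
move=> cg ch y Jy; have [g1 g2] := cg y Jy; have [h1 h2] := ch y Jy; split.
- have -> : (fun t => complex.Re (g t * h t)) = (fun t =>
      complex.Re (g t) * complex.Re (h t) - complex.Im (g t) * complex.Im (h t)).
    by apply/funext => t; rewrite ReM.
  by apply: cvgB; apply: cvgM.
- have -> : (fun t => complex.Im (g t * h t)) = (fun t =>
      complex.Re (g t) * complex.Im (h t) + complex.Im (g t) * complex.Re (h t)).
    by apply/funext => t; rewrite ImM.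
  by apply: cvgD; apply: cvgM.
Qed.

Lemma ccontinuousD J g h : ccontinuous J g -> ccontinuous J h ->
  ccontinuous J (fun t => g t + h t).
Proof.
move=> cg ch y Jy; have [g1 g2] := cg y Jy; have [h1 h2] := ch y Jy; split.
- have -> : (fun t => complex.Re (g t + h t)) =
      (fun t => complex.Re (g t) + complex.Re (h t)).
    by apply/funext => t; rewrite ReD.
  exact: cvgD.
- have -> : (fun t => complex.Im (g t + h t)) =
      (fun t => complex.Im (g t) + complex.Im (h t)).
    by apply/funext => t; rewrite ImD.
  exact: cvgD.
Qed.

Lemma ccontinuous_cst J (c : R[i]) : ccontinuous J (fun=> c).
Proof. by move=> y _; split; exact: cst_continuous. Qed.

Lemma ccontinuous_real J (g : R -> R) :
  (forall y, J y -> {for y, continuous g}) ->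
  ccontinuous J (fun t => (g t)%:C).
Proof. by move=> cg y Jy; split => /=; [exact: cg|exact: cst_continuous]. Qed.

Lemma ccontinuous_cpow J (g : R -> R) (s : R[i]) :
  (forall y, J y -> {for y, continuous g}) -> (forall y, J y -> 0 < g y) ->
  ccontinuous J (fun t => cpow (g t) s).
Proof.
move=> cg g0 y Jy.
have cl : {for y, continuous (fun t => ln (g t))}.
  by apply: continuous_comp; [exact: cg|exact/continuous_ln/g0].
have cE : {for y, continuous (fun t => expR (complex.Re s * ln (g t)))}.
  apply: (@continuous_comp _ _ _ (fun t => complex.Re s * ln (g t)) expR).
    by apply: cvgMr.
  exact: continuous_expR.
have cI : {for y, continuous (fun t => complex.Im s * ln (g t))} by apply: cvgMr.
split.
- have -> : (fun t => complex.Re (cpow (g t) s)) = (fun t =>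
      expR (complex.Re s * ln (g t)) * cos (complex.Im s * ln (g t))).
    by apply/funext => t; rewrite Re_cpow.
  apply: cvgM => //.
  apply: (@continuous_comp _ _ _ (fun t => complex.Im s * ln (g t)) cos) => //.
  exact: continuous_cos.
- have -> : (fun t => complex.Im (cpow (g t) s)) = (fun t =>
      expR (complex.Re s * ln (g t)) * sin (complex.Im s * ln (g t))).
    by apply/funext => t; rewrite Im_cpow.
  apply: cvgM => //.
  apply: (@continuous_comp _ _ _ (fun t => complex.Im s * ln (g t)) sin) => //.
  exact: continuous_sin.
Qed.

End continuity.

(** * Scalings, powers and a homography *)

Section substitution_maps.
Variable R : realType.
Implicit Types (t c x p : R).
Local Notation pos := (`]0%R, +oo[%classic : set (measurableTypeR R)).

Lemma posE t : pos t <-> 0 < t.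
Proof. by rewrite /= in_itv/= andbT. Qed.

Lemma onto_scale c : 0 < c -> increasing_onto pos (fun t => c * t) (fun=> c).
Proof.
move=> c0; split.
- by move=> t t0; apply/posE; rewrite mulr_gt0.
- move=> y /posE y0; exists (c^-1 * y); first by rewrite mulr_gt0 ?invr_gt0.
  by rewrite mulVKf ?gt_eqF.
- by move=> s t _ st; rewrite ltr_pM2l.
- by move=> t _; apply: is_derive_eq; rewrite scaler1.
- by move=> t _; exact: ltW.
- by move=> t _; exact: cst_continuous.
Qed.

Lemma continuous_powR p t : 0 < t -> {for t, continuous (fun u => u `^ p)}.
Proof.
move=> t0; apply/differentiable_continuous/derivable1_diffP.
by apply: derivable_powR; rewrite in_itv/= t0.
Qed.

(** With [p = k] this map turns the k-Gamma integral into the Gamma integral;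
    with [p = s] its derivative absorbs the singularity [t^(s-1)] at 0. *)
Lemma onto_powR p : 0 < p ->
  increasing_onto pos (fun t => t `^ p / p) (fun t => t `^ (p - 1)).
Proof.
move=> p0; split.
- by move=> t t0; apply/posE; rewrite divr_gt0 ?powR_gt0.
- move=> y /posE y0; exists ((p * y) `^ p^-1).
    by rewrite powR_gt0 ?mulr_gt0.
  rewrite -powRrM mulVf ?gt_eqF// powRr1; last by rewrite mulr_ge0// ltW.
  by rewrite mulrC mulKf ?gt_eqF.
- move=> s t s0 st; rewrite ltr_pM2r ?invr_gt0// gt0_ltr_powR// nnegrE ltW//.
  exact: lt_trans st.
- move=> t t0.
  have -> : t `^ (p - 1) = p^-1 *: (p * t `^ (p - 1)).
    by rewrite /GRing.scale/= mulKf ?gt_eqF.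
  have -> : (fun t => t `^ p / p) = p^-1 \*: (fun t => t `^ p).
    by apply/funext => u /=; rewrite mulrC.
  by apply: is_deriveZ; exact: is_derive1_powR.
- by move=> t _; exact: powR_ge0.
- by move=> t t0; exact: continuous_powR.
Qed.

(** For [t = x w / (1 + w)] one has [x - t = x / (1 + w)]: this map carries
    the Beta integral over the half line to the fractional integral. *)
Lemma onto_mobius x : 0 < x ->
  increasing_onto `]0, x[ (fun w => x * w / (1 + w)) (fun w => x / (1 + w) ^+ 2).
Proof.
move=> x0; split.
- move=> t t0; rewrite /= in_itv/= divr_gt0 ?mulr_gt0 ?addr_gt0//=.
  by rewrite ltr_pdivrMr ?addr_gt0// ltr_pM2l// ltrDr.
- move=> y; rewrite /= in_itv/= => /andP[y0 yx].
  have d0 : 0 < x - y by rewrite subr_gt0.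
  exists (y / (x - y)); first by rewrite divr_gt0.
  by field; rewrite !gt_eqF//= (_ : x - y + y = x)//; ring.
- move=> s t s0 st; rewrite -!mulrA ltr_pM2l//.
  have t0 : 0 < t by exact: lt_trans st.
  rewrite ltr_pdivrMr ?addr_gt0// mulrAC ltr_pdivlMr ?addr_gt0//.
  by rewrite !mulrDr !mulr1 [t * s]mulrC ltrD2r.
- move=> t t0; have d0 : 1 + t != 0 by rewrite gt_eqF// addr_gt0.
  have dD : is_derive t 1 (fun w : R => 1 + w) 1.
    have := is_deriveD (is_derive_cst (1 : R) t 1) (is_derive_id t (1 : R)).
    by rewrite add0r.
  have dV : is_derive t 1 (fun w : R => (1 + w)^-1) (- (1 + t) ^- 2 *: 1).
    exact: (is_deriveV d0).
  have dM : is_derive t 1 (fun w : R => x * w) x.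
    have := is_deriveZ x (is_derive_id t (1 : R)).
    by rewrite /GRing.scale/= mulr1.
  apply: (is_derive_eq (is_deriveM dM dV)).
  by rewrite /GRing.scale /=; field.
- by move=> t t0; rewrite divr_ge0// ?sqr_ge0 ?ltW.
- move=> t t0; apply: cvgM; first exact: cvg_cst.
  apply: cvgV; first by rewrite expf_neq0// gt_eqF// addr_gt0.
  apply: (@continuous_comp _ _ _ (fun w : R => 1 + w) (fun w => w ^+ 2)).
    by apply: cvgD; [exact: cvg_cst|exact: cvg_id].
  exact: exprn_continuous.
Qed.

End substitution_maps.

(** * Integrals of derivatives over the half line *)

Section half_line_FTC.
Variable R : realType.
Local Notation mu := (@lebesgue_measure R).
Local Notation pos := (`]0%R, +oo[%classic : set (measurableTypeR R)).
Implicit Types t : R.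

Let mpos : measurable (pos : set (measurableTypeR R)).
Proof. exact: measurable_itv. Qed.

(** Fundamental theorem of calculus on the half line, for a primitive that
    vanishes at both ends; the two sequences along which it is asked to vanish
    are those that bound the exhausting intervals. *)
Lemma Rintegral_derive0 (F f : R -> R) :
  (forall t, 0 < t -> is_derive t 1 F (f t)) ->
  (forall t, 0 < t -> {for t, continuous f}) ->
  mu.-integrable pos (EFin \o f) ->
  F n.+1%:R^-1 @[n --> \oo] --> 0 -> F n.+1%:R @[n --> \oo] --> 0 ->
  Rintegral mu pos f = 0.
Proof.
move=> dF cf intf F0 Fy.
pose I n : set (measurableTypeR R) := `[n.+2%:R^-1, n.+2%:R]%classic.
have oP n : 0 < n.+2%:R^-1 :> R by rewrite invr_gt0.
have lt_oP n : n.+2%:R^-1 < n.+2%:R :> R.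
  by rewrite (@lt_trans _ _ 1)// ?invf_lt1// ltr1n.
have mI n : measurable (I n) by exact: measurable_itv.
have Ipos n : I n `<=` pos.
  move=> t; rewrite /I /= !in_itv/= andbT => /andP[t1 _].
  exact: lt_le_trans t1.
have cF t : 0 < t -> {for t, continuous F}.
  by move=> t0; apply/differentiable_continuous/derivable1_diffP; have [] := dF t t0.
have E n : Rintegral mu pos (f \_ (I n)) = F n.+2%:R - F n.+2%:R^-1.
  rewrite -Rintegral_mkcondr setIidr// /Rintegral.
  rewrite (@continuous_FTC2 _ f F)//.
  - apply: continuous_in_subspaceT => t /set_mem /Ipos /posE; exact: cf.
  - split.
    + move=> t; rewrite in_itv/= => /andP[t1 _].
      by have [] := dF t (lt_trans (oP n) t1).
    + by apply: cvg_at_right_filter; apply: cF.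
    + by apply: cvg_at_left_filter; apply: cF.
  - move=> t; rewrite in_itv/= => /andP[t1 _].
    by rewrite derive1E; have [] := dF t (lt_trans (oP n) t1).
have [||||_ cvgf] := @Rdominated_convergence R pos (fun n => f \_ (I n)) f
    (fun t => `|f t|) mpos.
- move=> n; have mf : measurable_fun pos f.
    by move: intf => /measurable_int/measurable_EFinP.
  have := (measurable_restrictT f (mI n)).1 (measurable_funS mpos (Ipos n) mf).
  exact: measurable_funS.
- move=> t /posE t0; have [N /andP[N1 N2]] := exhaustion_pos t0.
  apply: cvg_near_cst; near=> n; rewrite patchT// inE /I /= in_itv/=.
  have Nn : (N <= n.+1)%N by rewrite leqW//; near: n; exact: nbhs_infty_ge.
  have /andP[h1 h2] := exhaustion_nd R Nn.
  by rewrite (le_trans h1 N1) (le_trans N2 h2).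
- exact: integrable_norm.
- by move=> n t _; rewrite /patch; case: ifP; rewrite ?normr0.
have cvg0 : F n.+2%:R - F n.+2%:R^-1 @[n --> \oo] --> (0 : R).
  rewrite -[X in _ --> X](subr0 (0 : R)); apply: cvgB.
  - by have := Fy; rewrite -cvg_shiftS.
  - by have := F0; rewrite -cvg_shiftS.
apply: (cvg_unique _ cvgf); first exact: Rhausdorff.
by rewrite (_ : (fun n => Rintegral mu pos (f \_ (I n))) =
  (fun n => F n.+2%:R - F n.+2%:R^-1)); [exact: cvg0|apply/funext => n; exact: E].
Unshelve. all: by end_near. Qed.

Lemma cintegral_derive0 (h f : R -> R[i]) :
  (forall t, 0 < t -> is_derive t 1 (fun u => complex.Re (h u)) (complex.Re (f t)) /\
                      is_derive t 1 (fun u => complex.Im (h u)) (complex.Im (f t))) ->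
  ccontinuous pos f -> cintegrable pos f ->
  normc (h n.+1%:R^-1) @[n --> \oo] --> 0 ->
  normc (h n.+1%:R) @[n --> \oo] --> 0 ->
  cintegral pos f = 0.
Proof.
move=> dh cf [i1 i2] h0 hy.
have sq (k : R[i] -> R) : (forall p, `|k p| <= normc p) ->
    (k (h n.+1%:R^-1) @[n --> \oo] --> 0) /\ (k (h n.+1%:R) @[n --> \oo] --> 0).
  have sq0 (u : nat -> R[i]) : (forall p, `|k p| <= normc p) ->
      normc (u n) @[n --> \oo] --> 0 -> k (u n) @[n --> \oo] --> 0.
    move=> kn u0; apply/norm_cvg0P.
    apply: (@squeeze_cvgr _ _ _ _ (cst 0) (fun n => normc (u n))) => //.
      by apply: nearW => n /=; rewrite normr_ge0 kn.
    exact: cvg_cst.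
  by move=> kn; split; exact: (sq0 (fun n => h _)).
have [r0 ry] := sq _ (@normc_geRe R); have [m0 my] := sq _ (@normc_geIm R).
apply: complexP => /=.
- apply: (Rintegral_derive0 (F := fun u => complex.Re (h u))) => //.
  + by move=> t /dh[].
  + by move=> t /posE /cf[].
- apply: (Rintegral_derive0 (F := fun u => complex.Im (h u))) => //.
  + by move=> t /dh[].
  + by move=> t /posE /cf[].
Qed.

End half_line_FTC.

(** * Integrability of the real Gamma integrand *)

Section real_gamma.
Variable R : realType.
Local Notation mu := (@lebesgue_measure R).
Local Notation pos := (`]0%R, +oo[%classic : set (measurableTypeR R)).

(** For [w <= 1] the power is at most 1; for [w >= 1] it is at most an integer
    power, which is one term of the exponential series. *)
Lemma powR_le_expR (a w : R) : 0 <= a -> 0 <= w ->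
  w `^ a <= (1 + (Num.truncn a).+1`!%:R) * expR w.
Proof.
move=> a0 w0; set m := (Num.truncn a).+1.
have am : a <= m%:R by rewrite ltW// /m truncnS_gt.
have e1 : 1 <= expR w by rewrite -expR0 ler_expR.
have wm : w ^+ m <= m`!%:R * expR w.
  have := expR_ge1Dxn (Num.truncn a) w0; rewrite -/m => h.
  have {}h : w ^+ m / m`!%:R <= expR w by apply: le_trans h; rewrite lerDr.
  by move: h; rewrite ler_pdivrMr ?ltr0n ?fact_gt0// mulrC.
rewrite mulrDl mul1r; have [w1|/ltW w1] := leP w 1.
  apply: (@le_trans _ _ (expR w)); last by rewrite lerDl mulr_ge0// expR_ge0.
  apply: le_trans e1; have [->|wn0] := eqVneq w 0.
    by rewrite /powR eqxx; case: (a == 0).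
  have /ger_powR h : 0 < w <= 1 by rewrite w1 lt_neqAle eq_sym wn0 w0.
  by have := h _ _ a0; rewrite powRr0.
rewrite -(powR_mulrn _ w0) in wm.
apply: (le_trans (ler_powR w1 am)); apply: (le_trans wm).
by rewrite lerDr expR_ge0.
Qed.

Lemma integrable_oneDsqrV (c : R) :
  mu.-integrable pos (fun t => (c * (oneDsqr t)^-1)%:E).
Proof.
have mV : measurable_fun pos (fun t : R => (oneDsqr t)^-1).
  apply: measurable_funTS; apply: continuous_measurable_fun.
  exact: continuous_oneDsqrV.
have i1 : mu.-integrable pos (EFin \o (fun t => (oneDsqr t)^-1)).
  apply/integrableP; split; first exact/measurable_EFinP.
  rewrite (_ : \int[mu]_(t in _) _ = \int[mu]_(t in pos) (oneDsqr t)^-1%:E)%E.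
    rewrite integral_itv_obnd_cbnd; last exact/measurable_EFinP.
    by rewrite integral0y_oneDsqr ltry.
  apply: eq_integral => t _ /=; congr EFin; apply: ger0_norm.
  by rewrite invr_ge0 (le_trans _ (oneDsqr_ge1 _)).
by apply: eq_integrable (integrableZl _ c i1) => //; exact: measurable_itv.
Qed.

(** The variable [u = t^s / s] removes the singularity at 0: the integrand
    becomes [exp (- (s u)^(1/s))], which is bounded by [c / (1 + u^2)]. *)
Lemma integrable_gamma (s : R) : 0 < s ->
  mu.-integrable pos (EFin \o (fun t => t `^ (s - 1) * expR (- t))).
Proof.
move=> s0; pose G u : R := expR (- (s * u) `^ s^-1).
have cG u : pos u -> {for u, continuous G}.
  move=> /posE u0; apply: (@continuous_comp _ _ _ (fun u => - (s * u) `^ s^-1) expR).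
    apply: cvgN; apply: (@continuous_comp _ _ _ (fun u => s * u) (fun u => u `^ s^-1)).
      by apply: cvgMr; exact: cvg_id.
    by apply: continuous_powR; rewrite mulr_gt0.
  exact: continuous_expR.
have oJ : open (pos : set R) by exact: interval_open.
have /iffLR := integrable_substitution (onto_powR s0) oJ cG.
have eqG : {in pos, EFin \o (fun t => G (t `^ s / s) * t `^ (s - 1)) =1
    EFin \o (fun t => t `^ (s - 1) * expR (- t))}.
  move=> t /set_mem/posE t0 /=; congr EFin; rewrite mulrC; congr (_ * _).
  rewrite /G mulrCA mulfV ?gt_eqF// mulr1 -powRrM mulfV ?gt_eqF// powRr1//.
  exact: ltW.
move=> h; apply: (eq_integrable _ _ _ eqG); first exact: measurable_itv.
apply: h.
(* With w = (s u)^(1/s) one has u^2 = w^(2s) / s^2, and the exponential of w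
   dominates w^(2s). *)
pose c : R := 1 + (1 + (Num.truncn (s * 2)).+1`!%:R) / s ^+ 2.
apply: (@le_integrable _ _ _ mu _ _ _ (fun t => (c * (oneDsqr t)^-1)%:E)).
- exact: measurable_itv.
- by apply/measurable_EFinP; apply: open_continuous_measurable_fun => // u /set_mem; exact: cG.
- move=> u /posE u0; rewrite lee_fin; apply: le_trans (ler_norm _).
  rewrite ger0_norm ?expR_ge0// /G expRN ler_pdivlMr; last first.
    by rewrite (lt_le_trans _ (oneDsqr_ge1 _)).
  rewrite mulrC ler_pdivrMr ?expR_gt0//.
  set w := (s * u) `^ s^-1.
  have w0 : 0 <= w by exact: powR_ge0.
  have uE : u ^+ 2 = w `^ (s * 2) / s ^+ 2.
    rewrite /w -powRrM mulrA mulVf ?gt_eqF// mul1r powR_mulrn; last first.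
      by rewrite mulr_ge0// ltW.
    by rewrite exprMn mulrC mulKf// expf_neq0// gt_eqF.
  rewrite /oneDsqr /c uE [leRHS]mulrDl mul1r lerD//.
    by rewrite -expR0 ler_expR.
  by rewrite mulrAC ler_pM2r ?invr_gt0 ?exprn_gt0// powR_le_expR// mulr_ge0// ltW.
- exact: integrable_oneDsqrV.
Qed.

End real_gamma.

(** * Exchange of two integrals *)

Section fubini.
Variable R : realType.
Local Notation mu := (@lebesgue_measure R).
Local Notation TR := (measurableTypeR R).

(** [H] is extended by zero outside of [D] times [D]; the double integral of
    its absolute value is at most that of [g], which is finite. *)
Lemma Rfubini (D : set TR) (H g : R -> R -> R) : measurable D ->
  measurable_fun setT (fun p : TR * TR => H p.1 p.2) ->
  (forall x y, D x -> D y -> `|H x y| <= g x y) ->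
  (forall x, D x -> mu.-integrable D (EFin \o g x)) ->
  (forall y, D y -> mu.-integrable D (EFin \o g^~ y)) ->
  mu.-integrable D (EFin \o (fun x => Rintegral mu D (g x))) ->
  mu.-integrable D (EFin \o (fun y => Rintegral mu D (H^~ y))) /\
  Rintegral mu D (fun x => Rintegral mu D (H x)) =
  Rintegral mu D (fun y => Rintegral mu D (H^~ y)).
Proof.
move=> mD mH Hg ig1 ig2 iG.
pose f : TR * TR -> \bar R := (fun p => (H p.1 p.2)%:E) \_ (D `*` D).
have mf : measurable_fun setT f.
  apply/(measurable_restrictT _ _).1; first exact: measurableX.
  by apply: measurable_funTS; exact/measurable_EFinP.
have m1 x : measurable_fun D (H x).
  apply: measurable_funTS.
  exact: (measurableT_comp mH (measurable_pair1 x)).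
have m2 y : measurable_fun D (H^~ y).
  apply: measurable_funTS.
  exact: (measurableT_comp mH (measurable_pair2 y)).
have i1 x : D x -> mu.-integrable D (EFin \o H x).
  move=> Dx; apply: (le_integrable mD _ _ (ig1 x Dx)); first exact/measurable_EFinP.
  by move=> y Dy; rewrite /= lee_fin (le_trans (Hg _ _ Dx Dy))// ler_norm.
have i2 y : D y -> mu.-integrable D (EFin \o H^~ y).
  move=> Dy; apply: (le_integrable mD _ _ (ig2 y Dy)); first exact/measurable_EFinP.
  by move=> x Dx; rewrite /= lee_fin (le_trans (Hg _ _ Dx Dy))// ler_norm.
have f1 x : (fun y => f (x, y)) = if x \in D then (EFin \o H x) \_ D else cst 0%E.
  apply/funext => y; rewrite /f /patch in_setX/=.
  by case: (x \in D).
have f2 y : (fun x => f (x, y)) = if y \in D then (EFin \o H^~ y) \_ D else cst 0%E.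
  apply/funext => x; rewrite /f /patch in_setX/= andbC.
  by case: (y \in D).
have F1 : (fun x => \int[mu]_y f (x, y))%E =
    (EFin \o (fun x => Rintegral mu D (H x))) \_ D.
  apply/funext => x; rewrite f1 /patch; case: ifPn => [/set_mem Dx|_].
    rewrite -integral_mkcond /= /Rintegral fineK//.
    exact: (integrable_fin_num mD (i1 _ Dx)).
  by rewrite integral0.
have F2 : (fun y => \int[mu]_x f (x, y))%E =
    (EFin \o (fun y => Rintegral mu D (H^~ y))) \_ D.
  apply/funext => y; rewrite f2 /patch; case: ifPn => [/set_mem Dy|_].
    rewrite -integral_mkcond /= /Rintegral fineK//.
    exact: (integrable_fin_num mD (i2 _ Dy)).
  by rewrite integral0.
have intf : (mu \x mu)%E.-integrable setT f.
  apply: (integrable12ltyP mu mu mf).2.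
  have mF : measurable_fun setT (fun x => \int[mu]_y `|f (x, y)|)%E.
    apply: (measurable_fun_fubini_tonelli_F (abse \o f)) => //=.
    exact: measurableT_comp.
  have fle x : (\int[mu]_y `|f (x, y)| <=
      ((EFin \o (fun x => Rintegral mu D (g x))) \_ D) x)%E.
    rewrite /patch; case: ifPn => [xD|xD].
      have Dx := set_mem xD.
      have -> : (fun y => `|f (x, y)|)%E = (fun y => `|H x y|%:E) \_ D.
        apply/funext => y; rewrite /f /patch in_setX/= xD.
        by case: (y \in D); rewrite ?abse0.
      rewrite -integral_mkcond /= /Rintegral fineK; last first.
        exact: (integrable_fin_num mD (ig1 _ Dx)).
      apply: ge0_le_integral => //.
      - by apply/measurable_EFinP; exact: measurableT_comp.
      - exact: measurable_int (ig1 _ Dx).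
      - by move=> y Dy; rewrite lee_fin Hg.
    have -> : (fun y => `|f (x, y)|)%E = cst 0%E.
      by apply/funext => y; rewrite /f /patch in_setX/= (negbTE xD) abse0.
    by rewrite integral0.
  apply: (@le_lt_trans _ _ (\int[mu]_x
      (((EFin \o (fun x => Rintegral mu D (g x))) \_ D) x))%E).
    apply: ge0_le_integral => //.
    - by move=> x _; apply: integral_ge0.
    - apply/(measurable_restrictT _ _).1 => //.
      exact: measurable_int iG.
  rewrite -integral_mkcond; exact: integrable_lty.
split.
- apply/(integrable_mkcond _ mD); rewrite -F2.
  apply/integrableP; split; first exact: measurable_fubini_G intf.
  apply: le_lt_trans ((integrable21ltyP mu mu mf).1 intf).
  apply: ge0_le_integral => //.
  - by apply: measurableT_comp => //; exact: measurable_fubini_G intf.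
  - apply: (measurable_fun_fubini_tonelli_G (abse \o f)) => //=.
    exact: measurableT_comp.
  - move=> y _; apply: le_abse_integral => //.
    exact: (measurableT_comp mf (measurable_pair2 y)).
- have := Fubini intf.
  rewrite F1 F2 -!integral_mkcond => h.
  by rewrite [LHS]/Rintegral [in RHS]/Rintegral h.
Qed.
Lemma cfubini (D : set TR) (H : R -> R -> R[i]) (g : R -> R -> R) :
  measurable D -> cmeasurable setT (fun p : TR * TR => H p.1 p.2) ->
  (forall x y, D x -> D y -> normc (H x y) <= g x y) ->
  (forall x, D x -> mu.-integrable D (EFin \o g x)) ->
  (forall y, D y -> mu.-integrable D (EFin \o g^~ y)) ->
  mu.-integrable D (EFin \o (fun x => Rintegral mu D (g x))) ->
  cintegral D (fun x => cintegral D (H x)) =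
  cintegral D (fun y => cintegral D (H^~ y)).
Proof.
move=> mD [mRe mIm] Hg ig1 ig2 iG; apply: complexP => /=.
- apply: (Rfubini (H := fun x y => complex.Re (H x y)) mD mRe _ ig1 ig2 iG).2.
  by move=> x y Dx Dy; exact: le_trans (normc_geRe _) (Hg _ _ Dx Dy).
- apply: (Rfubini (H := fun x y => complex.Im (H x y)) mD mIm _ ig1 ig2 iG).2.
  by move=> x y Dx Dy; exact: le_trans (normc_geIm _) (Hg _ _ Dx Dy).
Qed.

End fubini.

(** * The Gamma integral in the right half plane *)

Section gamma_integral.
Variable R : realType.
Local Notation mu := (@lebesgue_measure R).
Local Notation pos := (`]0%R, +oo[%classic : set (measurableTypeR R)).
Implicit Types (z a b : R[i]) (s t c : R).

Let mpos : measurable (pos : set (measurableTypeR R)).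
Proof. exact: measurable_itv. Qed.

Let opos : open (pos : set R). Proof. exact: interval_open. Qed.

Lemma ccontinuous_gamma z :
  ccontinuous pos (fun t => cpow t (z - 1) * (expR (- t))%:C).
Proof.
apply: ccontinuousM.
  by apply: ccontinuous_cpow => y /posE// y0; exact: cvg_id.
apply: ccontinuous_real => y _.
apply: (@continuous_comp _ _ _ (fun t : R => - t) expR).
  by apply: cvgN; exact: cvg_id.
exact: continuous_expR.
Qed.

Lemma cintegrable_gamma z : 0 < complex.Re z ->
  cintegrable pos (fun t => cpow t (z - 1) * (expR (- t))%:C).
Proof.
move=> z0; apply: (cintegrable_dom mpos _ (integrable_gamma z0)).
  apply: cmeasurableM; first exact: cmeasurable_cpow.
  by apply: cmeasurable_real; apply: measurableT_comp => //; exact: measurableT_comp.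
move=> t /posE t0; rewrite normcM normc_cpow// normc_real ReD ReN/=.
by rewrite ger0_norm ?expR_ge0.
Qed.

(** Substitution of [c t] for [t] in the Gamma integral. *)
Lemma gamma_scale z c : 0 < complex.Re z -> 0 < c ->
  cintegrable pos (fun t => cpow t (z - 1) * (expR (- (c * t)))%:C) /\
  cintegral pos (fun t => cpow t (z - 1) * (expR (- (c * t)))%:C) =
  cpow c (- z) * euler_gamma z.
Proof.
move=> z0 c0.
have [ic ec] := csubstitution (onto_scale c0) opos (ccontinuous_gamma z).
have := ic.1 (cintegrable_gamma z0).
move: ec; rewrite -/(euler_gamma z) => -> ig.
have [iZ eZ] := cintegralZ (cpow c (- z)) mpos ig.
have E t : pos t ->
  cpow c (- z) * (cpow (c * t) (z - 1) * (expR (- (c * t)))%:C * c%:C) =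
  cpow t (z - 1) * (expR (- (c * t)))%:C.
  move=> /posE t0; rewrite cpowM// cpowB cpowN cpow1//.
  by field; rewrite cpow_neq0 /= (inj_eq (@complexI R)) gt_eqF.
by rewrite -eZ; split; [exact: eq_cintegrable iZ|exact/esym/eq_cintegral].
Qed.

Definition rgamma s : R := Rintegral mu pos (fun t => t `^ (s - 1) * expR (- t)).

Lemma euler_gamma_real s : 0 < s -> euler_gamma s%:C = (rgamma s)%:C.
Proof.
move=> s0; rewrite -cintegral_real; apply: eq_cintegral => t /posE t0.
by rewrite -(rmorphB (real_complex R) s 1) cpow_real// rmorphM.
Qed.

Lemma rgamma_scale s c : 0 < s -> 0 < c ->
  mu.-integrable pos (EFin \o (fun t => t `^ (s - 1) * expR (- (c * t)))) /\
  Rintegral mu pos (fun t => t `^ (s - 1) * expR (- (c * t))) =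
  c `^ (- s) * rgamma s.
Proof.
move=> s0 c0; have E t : pos t ->
    cpow t (s%:C - 1) * (expR (- (c * t)))%:C =
    (t `^ (s - 1) * expR (- (c * t)))%:C.
  by move=> /posE t0; rewrite -(rmorphB (real_complex R) s 1) cpow_real// rmorphM.
have [i1 e1] := @gamma_scale s%:C c s0 c0.
have [i2 _] := eq_cintegrable mpos E i1.
split; first exact: i2.
apply: complexI; rewrite -cintegral_real -(eq_cintegral E) e1.
by rewrite euler_gamma_real// -rmorphN cpow_real// rmorphM.
Qed.

(** On [1, 2] the integrand is at least [t^(-1) e^(-2)], because [s - 1 > -1]. *)
Lemma rgamma_gt0 s : 0 < s -> 0 < rgamma s.
Proof.
move=> s0; have ig := integrable_gamma s0.
have sub : `[1, 2%:R] `<=` (pos : set R).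
  move=> t; rewrite /= !in_itv/= andbT => /andP[t1 _].
  exact: lt_le_trans t1.
have i12 : mu.-integrable `[1, 2%:R] (EFin \o (fun t => t `^ (s - 1) * expR (- t))).
  by apply: integrableS ig => //; exact: measurable_itv.
apply: (@lt_le_trans _ _ (Rintegral mu `[1%R, 2%:R]
   (fun=> 2^-1 * expR (- 2)))).
  rewrite Rintegral_cst; last exact: measurable_itv.
  rewrite /= lebesgue_measure_itv /= lte_fin ltr1n /= mulr_gt0//.
apply: (@le_trans _ _ (Rintegral mu `[1%R, 2%:R]
   (fun t => t `^ (s - 1) * expR (- t)))).
  apply: le_Rintegral => //.
  - apply/integrableP; split; first exact/measurable_EFinP/measurable_cst.
    rewrite (_ : (fun x => _) = cst `|2^-1 * expR (- 2)|%:E)//.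
    rewrite integral_cst; last exact: measurable_itv.
    by rewrite /= lebesgue_measure_itv /= lte_fin ltr1n /= -EFinM ltry.
  - move=> t; rewrite /= in_itv/= => /andP[t1 t2].
    apply: ler_pM => //.
    + apply: (@le_trans _ _ (t `^ (-1))).
        have t0 : 0 < t by exact: lt_le_trans t1.
        by rewrite powR_inv1 ?(ltW t0)// lef_pV2 ?posrE.
      by apply: ler_powR => //; rewrite lerBrDr addNr ltW.
    + by rewrite ler_expR lerN2.
rewrite /rgamma /Rintegral fine_le//.
- by apply: integrable_fin_num i12; exact: measurable_itv.
- exact: (integrable_fin_num mpos ig).
- apply: ge0_subset_integral => //.
  + exact: measurable_int ig.
  + move=> t /posE t0; rewrite lee_fin mulr_ge0 ?powR_ge0 ?expR_ge0//.
Qed.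

End gamma_integral.

(** * The Beta identity *)

Section gamma_beta.
Variable R : realType.
Local Notation mu := (@lebesgue_measure R).
Local Notation pos := (`]0%R, +oo[%classic : set (measurableTypeR R)).
Local Notation TR := (measurableTypeR R).
Implicit Types (z a b : R[i]) (s t c : R).

Let mpos : measurable (pos : set (measurableTypeR R)).
Proof. exact: measurable_itv. Qed.

(** Fubini's theorem for [t^(a+b-1) w^(b-1) e^(-t(1+w))]: the inner integral
    is a scaled Gamma integral in either order, with scale [t] when [w] is the
    inner variable and scale [1 + w] when [t] is. *)
Lemma gamma_beta a b : 0 < complex.Re a -> 0 < complex.Re b ->
  let h := fun w => cpow w (b - 1) * cpow (1 + w) (- (a + b)) in
  cintegrable pos h /\
  euler_gamma a * euler_gamma b = euler_gamma (a + b) * cintegral pos h.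
Proof.
move=> a0 b0 h.
set A := complex.Re a; set B := complex.Re b.
have ab0 : 0 < complex.Re (a + b) by rewrite ReD addr_gt0.
have AB0 : 0 < A + B by rewrite addr_gt0.
pose H t w : R[i] :=
  cpow t (a + b - 1) * (cpow w (b - 1) * (expR (- (t * (1 + w))))%:C).
pose g t w : R := t `^ (A + B - 1) * (w `^ (B - 1) * expR (- (t * (1 + w)))).
have mg : measurable_fun setT (fun p : TR * TR => expR (- (p.1 * (1 + p.2)))).
  apply: measurableT_comp => //; apply: measurableT_comp => //.
  by apply: measurable_funM => //; exact: measurable_funD.
have mg' : measurable_fun setT (fun p : TR * TR => g p.1 p.2).
  apply: measurable_funM.
    by apply: (measurableT_comp (measurable_powR _)).
  apply: measurable_funM => //.
  by apply: (measurableT_comp (measurable_powR _)).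
have mH : cmeasurable setT (fun p : TR * TR => H p.1 p.2).
  apply: cmeasurableM; first exact: cmeasurable_cpow.
  apply: cmeasurableM; first exact: cmeasurable_cpow.
  exact: cmeasurable_real.
have g0 t w : 0 <= g t w by rewrite !mulr_ge0 ?powR_ge0 ?expR_ge0.
have Hg t w : pos t -> pos w -> normc (H t w) = g t w.
  move=> /posE t0 /posE w0; rewrite /H !normc_cpowM// normc_real.
  by rewrite ger0_norm ?expR_ge0// !(ReD, ReN).
have gE t w : g t w = t `^ (A + B - 1) * expR (- t) * (w `^ (B - 1) * expR (- (t * w))).
  by rewrite /g mulrDr mulr1 opprD expRD; ring.
have HE t w : H t w = cpow t (a + b - 1) * (expR (- t))%:C *
    (cpow w (b - 1) * (expR (- (t * w)))%:C).
  by rewrite /H mulrDr mulr1 opprD expRD rmorphM; ring.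
have gE' t w : g t w = w `^ (B - 1) * (t `^ (A + B - 1) * expR (- ((1 + w) * t))).
  by rewrite /g [t * _]mulrC; ring.
have HE' t w : H t w = cpow w (b - 1) * (cpow t (a + b - 1) * (expR (- ((1 + w) * t)))%:C).
  by rewrite /H [t * _]mulrC; ring.
have ig1 t : pos t -> mu.-integrable pos (EFin \o g t) /\
    Rintegral mu pos (g t) = t `^ (A - 1) * expR (- t) * rgamma B.
  move=> /posE t0; have [i e] := rgamma_scale b0 t0.
  split.
    apply: (eq_integrable mpos) (integrableZl mpos (t `^ (A + B - 1) * expR (- t)) i).
    by move=> w _ /=; rewrite gE.
  transitivity (Rintegral mu pos (fun w =>
      t `^ (A + B - 1) * expR (- t) * (w `^ (B - 1) * expR (- (t * w))))).
    by apply: eq_Rintegral => w _; exact: gE.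
  rewrite (RintegralZl _ mpos i) e.
  have -> : t `^ (A + B - 1) = t `^ (A - 1) * t `^ B.
    by rewrite -powRD; [congr (_ `^ _); ring|rewrite (gt_eqF t0) implybT].
  rewrite powRN; field.
  by rewrite gt_eqF// powR_gt0.
have ig2 w : pos w -> mu.-integrable pos (EFin \o g^~ w) /\
    Rintegral mu pos (g^~ w) =
      rgamma (A + B) * (w `^ (B - 1) * (1 + w) `^ (- (A + B))).
  move=> /posE w0; have w1 : 0 < 1 + w by rewrite addr_gt0.
  have [i e] := rgamma_scale AB0 w1.
  split.
    apply: (eq_integrable mpos) (integrableZl mpos (w `^ (B - 1)) i).
    by move=> t _ /=; rewrite gE'.
  transitivity (Rintegral mu pos (fun t =>
      w `^ (B - 1) * (t `^ (A + B - 1) * expR (- ((1 + w) * t))))).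
    by apply: eq_Rintegral => t _; exact: gE'.
  by rewrite (RintegralZl _ mpos i) e; ring.
have iG : mu.-integrable pos (EFin \o (fun t => Rintegral mu pos (g t))).
  apply: (eq_integrable mpos) (integrableZr mpos (rgamma B) (integrable_gamma a0)).
  by move=> t /set_mem post /=; rewrite (ig1 t post).2.
have Hg' x y : pos x -> pos y -> normc (H x y) <= g x y.
  by move=> Dx Dy; rewrite Hg.
have ag' x y : pos x -> pos y -> `|g x y| <= g x y.
  by move=> Dx Dy; rewrite ger0_norm.
have cF := cfubini mpos mH Hg' (fun t Dt => (ig1 t Dt).1)
  (fun w Dw => (ig2 w Dw).1) iG.
(* The same exchange for the modulus makes the Beta integrand integrable, since
   the Gamma factor that comes with it is positive. *)
have [iR _] := Rfubini mpos mg' ag' (fun t Dt => (ig1 t Dt).1)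
  (fun w Dw => (ig2 w Dw).1) iG.
have ih : cintegrable pos h.
  have G0 : rgamma (A + B) != 0 by exact: lt0r_neq0 (rgamma_gt0 AB0).
  apply: (@cintegrable_dom _ _ _
      (fun w => (rgamma (A + B))^-1 * Rintegral mu pos (g^~ w)) mpos).
  - apply: cmeasurableM; first exact: cmeasurable_cpow.
    by apply: cmeasurable_cpow; exact: measurable_funD.
  - by have := integrableZl mpos (rgamma (A + B))^-1 iR; apply: eq_integrable.
  - move=> w post; rewrite (ig2 w post).2 (mulKf G0).
    move/posE : post => w0.
    have w1 : 0 < 1 + w by rewrite addr_gt0.
    have -> : normc (h w) = w `^ (B - 1) * (1 + w) `^ (- (A + B)).
      by rewrite /h (normc_cpowM _ _ w0) (normc_cpow _ w1) ReN ReD ReD ReN.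
    exact: lexx.
split; first exact: ih.
have L t : pos t -> cintegral pos (H t) =
    euler_gamma b * (cpow t (a - 1) * (expR (- t))%:C).
  move=> /posE t0; have [i e] := gamma_scale b0 t0.
  rewrite (eq_cintegral (fun w _ => HE t w)) (cintegralZ _ mpos i).2 e.
  have -> : cpow t (a + b - 1) = cpow t (a - 1) * cpow t b.
    by rewrite -cpowD; congr cpow; ring.
  rewrite cpowN; field.
  exact: cpow_neq0.
have M w : pos w -> cintegral pos (H^~ w) = euler_gamma (a + b) * h w.
  move=> /posE w0; have w1 : 0 < 1 + w by rewrite addr_gt0.
  have [i e] := gamma_scale ab0 w1.
  rewrite (eq_cintegral (fun t _ => HE' t w)) (cintegralZ _ mpos i).2 e.
  by rewrite /h; ring.
rewrite mulrC -(cintegralZ _ mpos (cintegrable_gamma a0)).2.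
rewrite -(eq_cintegral L) cF (eq_cintegral M).
by rewrite (cintegralZ _ mpos ih).2.
Qed.

End gamma_beta.

(** * Recursion and absence of zeros *)

Section gamma_theory.
Variable R : realType.
Local Notation mu := (@lebesgue_measure R).
Local Notation pos := (`]0%R, +oo[%classic : set (measurableTypeR R)).
Implicit Types (z a b : R[i]) (s t c : R).

Let mpos : measurable (pos : set (measurableTypeR R)).
Proof. exact: measurable_itv. Qed.

Lemma is_derive_cpow z t : 0 < t ->
  is_derive t 1 (fun u => complex.Re (cpow u z))
    (complex.Re (z * cpow t (z - 1))) /\
  is_derive t 1 (fun u => complex.Im (cpow u z))
    (complex.Im (z * cpow t (z - 1))).
Proof.
move=> t0; set x := complex.Re z; set y := complex.Im z.
have dl := is_derive1_ln t0.
have dlin (r : R) : is_derive t 1 (fun u : R => r * ln u) (r * t^-1).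
  exact: is_deriveZ.
have dE : is_derive t 1 (fun u => expR (x * ln u)) (expR (x * ln t) * (x * t^-1)).
  exact: (@is_derive1_comp _ expR (fun u => x * ln u)).
have dC : is_derive t 1 (fun u => cos (y * ln u)) (- sin (y * ln t) * (y * t^-1)).
  exact: (@is_derive1_comp _ cos (fun u => y * ln u)).
have dS : is_derive t 1 (fun u => sin (y * ln u)) (cos (y * ln t) * (y * t^-1)).
  exact: (@is_derive1_comp _ sin (fun u => y * ln u)).
have ReE u : complex.Re (cpow u z) = expR (x * ln u) * cos (y * ln u).
  by rewrite Re_cpow.
have ImE u : complex.Im (cpow u z) = expR (x * ln u) * sin (y * ln u).
  by rewrite Im_cpow.
have ReZ (r : R) p : complex.Re (z * (r%:C * p)) =
    r * (x * complex.Re p - y * complex.Im p).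
  by rewrite ReM [complex.Re (r%:C * p)]ReM [complex.Im (r%:C * p)]ImM /= -/x -/y; ring.
have ImZ (r : R) p : complex.Im (z * (r%:C * p)) =
    r * (x * complex.Im p + y * complex.Re p).
  by rewrite ImM [complex.Re (r%:C * p)]ReM [complex.Im (r%:C * p)]ImM /= -/x -/y; ring.
have D : cpow t (z - 1) = (t^-1)%:C * cpow t z.
  by rewrite cpowB cpow1// fmorphV mulrC.
split.
- have -> : (fun u => complex.Re (cpow u z)) =
    (fun u => expR (x * ln u)) * (fun u => cos (y * ln u)).
    by apply/funext => u; rewrite ReE.
  apply: is_derive_eq (is_deriveM dE dC) _.
  rewrite D ReZ ReE ImE /GRing.scale /=; ring.
- have -> : (fun u => complex.Im (cpow u z)) =
    (fun u => expR (x * ln u)) * (fun u => sin (y * ln u)).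
    by apply/funext => u; rewrite ImE.
  apply: is_derive_eq (is_deriveM dE dS) _.
  rewrite D ImZ ReE ImE /GRing.scale /=; ring.
Qed.

Lemma gamma_decay0 s : 0 < s ->
  (n.+1%:R^-1) `^ s * expR (- n.+1%:R^-1) @[n --> \oo] --> (0 : R).
Proof.
move=> s0; apply: (@squeeze_cvgr _ _ _ _ (cst 0) (fun n => (n.+1%:R^-1) `^ s)).
- near=> n; rewrite mulr_ge0 ?powR_ge0 ?expR_ge0//= ler_piMr ?powR_ge0//.
- exact: cvg_cst.
- have /cvg_at_rightP := powR_cvg0 s0; apply; split; first by move=> n; rewrite invr_gt0.
  exact: cvg_harmonic.
Unshelve. all: by end_near. Qed.

Lemma gamma_decayy s : 0 < s ->
  n.+1%:R `^ s * expR (- n.+1%:R) @[n --> \oo] --> (0 : R).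
Proof.
move=> s0; pose c : R := 1 + (Num.truncn (s + 1)).+1`!%:R.
apply: (@squeeze_cvgr _ _ _ _ (cst 0) (fun n => c * n.+1%:R^-1)).
- near=> n; rewrite mulr_ge0 ?powR_ge0 ?expR_ge0//=.
  rewrite expRN ler_pdivrMr ?expR_gt0// mulrAC ler_pdivlMr// mulrC.
  (* The bound at exponent s + 1 leaves a factor 1 / (n + 1) to spare. *)
  have -> : n.+1%:R * n.+1%:R `^ s = n.+1%:R `^ (s + 1) :> R.
    by rewrite powRD ?powRr1// ?pnatr_eq0 ?implybT// mulrC.
  by apply: powR_le_expR => //; rewrite addr_ge0// ltW.
- exact: cvg_cst.
- by rewrite -[X in _ --> X](mulr0 c); apply: cvgMr; exact: cvg_harmonic.
Unshelve. all: by end_near. Qed.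

(** The integral over the half line of the derivative of [t^z e^(-t)], which is
    [z t^(z-1) e^(-t) - t^z e^(-t)], is zero. *)
Lemma gamma_rec z : 0 < complex.Re z -> euler_gamma (z + 1) = z * euler_gamma z.
Proof.
move=> z0.
have z10 : 0 < complex.Re (z + 1) by rewrite ReD addr_gt0 /=.
have zE : z + 1 - 1 = z by ring.
pose e t : R[i] := (expR (- t))%:C.
pose h t : R[i] := cpow t z * e t.
pose f t : R[i] := z * (cpow t (z - 1) * e t) + (- 1) * (cpow t (z + 1 - 1) * e t).
have i1 := cintegrable_gamma z0.
have i2 := cintegrable_gamma z10.
have [iz ez] := cintegralZ z mpos i1.
have [iN eN] := cintegralZ (-1) mpos i2.
have [if_ ef] := cintegralD mpos iz iN.
have fE t : f t = (z * cpow t (z - 1) - cpow t z) * e t.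
  by rewrite /f zE; ring.
have de t : is_derive t 1 (fun u : R => expR (- u)) (- expR (- t)).
  have := @is_derive1_comp _ expR -%R t _ _ (is_derive_expR _)
    (is_deriveN (is_derive_id t (1 : R))).
  by rewrite mulrN1.
have nh t : 0 < t -> normc (h t) = t `^ complex.Re z * expR (- t).
  by move=> t0; rewrite /h (normc_cpowM _ _ t0) normc_real (ger0_norm (expR_ge0 _)).
have ReR (p : R[i]) r : complex.Re (p * r%:C) = complex.Re p * r.
  by rewrite ReM /= mulr0 subr0.
have ImR (p : R[i]) r : complex.Im (p * r%:C) = complex.Im p * r.
  by rewrite ImM /= mulr0 add0r.
have f0 : cintegral pos f = 0.
  apply: (cintegral_derive0 (h := h)).
  - move=> t t0; have [d1 d2] := is_derive_cpow z t0; split.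
    + have -> : (fun u => complex.Re (h u)) =
          (fun u => complex.Re (cpow u z)) * (fun u => expR (- u)).
        by apply/funext => u; rewrite /h /e ReR.
      apply: (is_derive_eq (is_deriveM d1 (de t))).
      by rewrite fE /e ReR ReD ReN /GRing.scale /=; ring.
    + have -> : (fun u => complex.Im (h u)) =
          (fun u => complex.Im (cpow u z)) * (fun u => expR (- u)).
        by apply/funext => u; rewrite /h /e ImR.
      apply: (is_derive_eq (is_deriveM d2 (de t))).
      by rewrite fE /e ImR ImD ImN /GRing.scale /=; ring.
  - have cE w w' : ccontinuous pos (fun t => w * (cpow t (w' - 1) * e t)).
      exact: (ccontinuousM (@ccontinuous_cst _ _ w) (ccontinuous_gamma w')).
    exact: (ccontinuousD (cE z z) (cE (-1) (z + 1))).
  - exact: if_.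
  - rewrite (_ : (fun n => _) = (fun n => (n.+1%:R^-1) `^ complex.Re z * expR (- n.+1%:R^-1))).
      exact: gamma_decay0.
    by apply/funext => n; rewrite nh// invr_gt0.
  - rewrite (_ : (fun n => _) = (fun n => n.+1%:R `^ complex.Re z * expR (- n.+1%:R))).
      exact: gamma_decayy.
    by apply/funext => n; rewrite nh.
have {}f0 : z * euler_gamma z + (- 1) * euler_gamma (z + 1) = 0.
  by rewrite -f0 -ez -eN -ef.
by apply/eqP; rewrite eq_sym -subr_eq0 -f0; apply/eqP; ring.
Qed.

(** A zero at [z] propagates to [z / 2^n] by the Beta identity with equal
    arguments, then to [1 + z / 2^n] by the recursion, and in the limit to 1. *)
Lemma gamma_neq0 z : 0 < complex.Re z -> euler_gamma z != 0.
Proof.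
move=> z0; apply/eqP => gz0.
pose e n : R := 2^-1 ^+ n.
have e0 n : 0 < e n by rewrite exprn_gt0// invr_gt0.
have e1 n : e n <= 1 by rewrite exprn_ile1// ?invr_ge0// invf_le1// ler1n.
pose w n : R[i] := z * (e n)%:C.
have Rew n : complex.Re (w n) = complex.Re z * e n by rewrite ReM /= mulr0 subr0.
have Imw n : complex.Im (w n) = complex.Im z * e n by rewrite ImM /= mulr0 add0r.
have w0 n : 0 < complex.Re (w n) by rewrite Rew mulr_gt0.
have wS n : w n = w n.+1 + w n.+1.
  rewrite /w -mulrDr -rmorphD; congr (_ * _%:C).
  by rewrite /e exprS; field.
have gw n : euler_gamma (w n) = 0.
  elim: n => [|n IH]; first by rewrite /w /e expr0 mulr1.
  have [_] := gamma_beta (w0 n.+1) (w0 n.+1).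
  rewrite -wS IH mul0r => /eqP; rewrite mulf_eq0 orbb; exact/eqP.
have gw1 n : euler_gamma (w n + 1) = 0.
  by rewrite gamma_rec// gw mulr0.
set s := complex.Re z.
(* The exponents Re z / 2^n lie between 0 and s: t to such a power is at most
   1 + t^s. *)
pose g t := t `^ (1 - 1) * expR (- t) + t `^ (s + 1 - 1) * expR (- t).
have s10 : 0 < s + 1 by rewrite addr_gt0.
have ig : mu.-integrable pos (EFin \o g).
  have := integrableD mpos (integrable_gamma (ltr01 : 0 < (1 : R))) (integrable_gamma s10).
  exact: eq_integrable.
have ecvg : e n @[n --> \oo] --> (0 : R).
  apply: cvg_expr; have e2 : 0 <= 2^-1 :> R by rewrite invr_ge0.
  by rewrite (ger0_norm e2) invf_lt1 ?ltr1n.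
pose f n t : R[i] := cpow t (w n + 1 - 1) * (expR (- t))%:C.
pose f1 t : R[i] := cpow t (1 - 1) * (expR (- t))%:C.
have w10 n : 0 < complex.Re (w n + 1) by rewrite ReD addr_gt0 /=.
have mf n : cmeasurable pos (f n).
  exact: cintegrable_measurable (cintegrable_gamma (w10 n)).
have wE n : w n + 1 - 1 = w n by ring.
have lim t : pos t -> ccvg (f^~ t) (f1 t).
  move=> _.
  have cvg_lin r : r * e n * ln t @[n --> \oo] --> (0 : R).
    have c1 : r * e n @[n --> \oo] --> r * 0 by exact: (cvgM (cvg_cst r) ecvg).
    have c2 : r * e n * ln t @[n --> \oo] --> r * 0 * ln t.
      exact: (cvgM c1 (cvg_cst (ln t))).
    by rewrite mulr0 mul0r in c2.
  have cE : expR (s * e n * ln t) @[n --> \oo] --> expR (0 : R).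
    by apply: continuous_cvg; [exact: continuous_expR|exact: cvg_lin].
  have cC : cos (complex.Im z * e n * ln t) @[n --> \oo] --> cos (0 : R).
    by apply: continuous_cvg; [exact: continuous_cos|exact: cvg_lin].
  have cS : sin (complex.Im z * e n * ln t) @[n --> \oo] --> sin (0 : R).
    by apply: continuous_cvg; [exact: continuous_sin|exact: cvg_lin].
  have fE n : f n t = (expR (- t))%:C * cpow t (w n) by rewrite /f wE mulrC.
  rewrite (_ : f^~ t = fun n => (expR (- t))%:C * cpow t (w n)); last first.
    by apply/funext => n; exact: fE.
  rewrite /f1 mulrC; apply: ccvgZ; rewrite subrr cpow0; split.
  - rewrite (_ : (fun n => _) = (fun n => expR (s * e n * ln t) *
        cos (complex.Im z * e n * ln t))); last first.
      by apply/funext => n; rewrite Re_cpow Rew Imw.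
    have := cvgM cE cC; rewrite expR0 cos0 mulr1 => h; exact: h.
  - rewrite (_ : (fun n => _) = (fun n => expR (s * e n * ln t) *
        sin (complex.Im z * e n * ln t))); last first.
      by apply/funext => n; rewrite Im_cpow Rew Imw.
    have := cvgM cE cS; rewrite sin0 mulr0 => h; exact: h.
have dom n t : pos t -> normc (f n t) <= g t.
  move=> /posE t0; rewrite /f wE (normc_cpowM _ _ t0) normc_real (ger0_norm (expR_ge0 _)).
  rewrite Rew /g -mulrDl ler_wpM2r ?expR_ge0// subrr powRr0.
  have -> : s + 1 - 1 = s by ring.
  have [t1|/ltW t1] := leP t 1.
  - apply: (@le_trans _ _ 1); last by rewrite lerDl powR_ge0.
    have t01 : 0 < t <= 1 by rewrite t0 t1.
    have se0 : 0 <= s * e n by rewrite mulr_ge0// ltW.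
    by have := ger_powR t01 se0; rewrite powRr0.
  - apply: (@le_trans _ _ (t `^ s)); last by rewrite lerDr ler01.
    by apply: ler_powR => //; rewrite ler_piMr// ltW.
have [_ cvgg] := cdominated_convergence mpos mf lim ig dom.
have g1 : euler_gamma (1 : R[i]) = 0.
  apply: (ccvg_unique cvgg).
  rewrite (_ : (fun n => cintegral pos (f n)) = fun=> 0).
    by split; exact: cvg_cst.
  by apply/funext => n; exact: gw1.
have := @euler_gamma_real R 1 ltr01.
rewrite g1 => /(congr1 (@complex.Re R)) /= g10.
by have := @rgamma_gt0 R 1 ltr01; rewrite -g10 ltxx.
Qed.

End gamma_theory.

(** * Fractional integral of a power, and the k-Gamma function *)

Section gamma_consequences.
Variable R : realType.
Local Notation pos := (`]0%R, +oo[%classic : set (measurableTypeR R)).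
Implicit Types (z a b s v : R[i]) (k t c x : R).

Let mpos : measurable (pos : set (measurableTypeR R)).
Proof. exact: measurable_itv. Qed.

Let opos : open (pos : set R). Proof. exact: interval_open. Qed.

Lemma Gamma_euler z : 0 < complex.Re z -> Gamma z = euler_gamma z.
Proof. by move=> z0; rewrite /Gamma /gamma_shift z0 big_ord0 divr1 addr0. Qed.

(** The Beta identity after the substitution [t = x w / (1 + w)]. *)
Lemma RL_power x a s : 0 < x -> 0 < complex.Re a -> 0 < complex.Re s ->
  let h := fun t => cpow (x - t) (a - 1) * cpow t (s - 1) in
  cintegrable `]0, x[ h /\
  cintegral `]0, x[ h =
    cpow x (a + s - 1) * (euler_gamma a * euler_gamma s / euler_gamma (a + s)).
Proof.
move=> x0 a0 s0 h.
have as0 : 0 < complex.Re (a + s) by rewrite ReD addr_gt0.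
have ch : ccontinuous `]0%R, x[%classic h.
  apply: ccontinuousM; apply: ccontinuous_cpow => t; rewrite /= in_itv/= => /andP[t0 tx].
  - by apply: cvgB; [exact: cvg_cst|exact: cvg_id].
  - by rewrite subr_gt0.
  - exact: cvg_id.
  - exact: t0.
have oJ : open (`]0%R, x[%classic : set R) by exact: interval_open.
have [ih eh] := csubstitution (onto_mobius x0) oJ ch.
have [ib eb] := gamma_beta a0 s0.
have E w : pos w -> cpow x (a + s - 1) *
    (cpow w (s - 1) * cpow (1 + w) (- (a + s))) =
    h (x * w / (1 + w)) * (x / (1 + w) ^+ 2)%:C.
  move=> /posE w0; have w1 : 0 < 1 + w by rewrite addr_gt0.
  rewrite /h.
  have -> : x - x * w / (1 + w) = x / (1 + w) by field; rewrite gt_eqF.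
  rewrite (cpow_div _ x0 w1) (cpow_div _ (mulr_gt0 x0 w0) w1) (cpowM _ x0 w0).
  have -> : (x / (1 + w) ^+ 2)%:C = cpow x 1 / (cpow (1 + w) 1 ^+ 2).
    by rewrite !cpow1// rmorphM fmorphV rmorphXn.
  rewrite !cpowB !cpowN !cpowD; field.
  by rewrite !cpow_neq0.
have [iZ eZ] := cintegralZ (cpow x (a + s - 1)) mpos ib.
split; first by apply/ih; exact: (eq_cintegrable mpos E iZ).
by rewrite eh -(eq_cintegral E) eZ eb [euler_gamma (a + s) * _]mulrC mulfK ?gamma_neq0.
Qed.

(** For [Re z > 0] this is the substitution [u = t^k / k] in the Gamma integral
    at [z / k]. *)
Lemma GammakE k z : 0 < k -> Gammak k z = cpow k (z / k%:C - 1) * Gamma (z / k%:C).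
Proof.
move=> k0; rewrite /Gammak; case: ifPn => // z0.
have zk0 : 0 < complex.Re (z / k%:C) by rewrite Re_divr divr_gt0.
have kC : k%:C != 0 by rewrite (inj_eq (@complexI R)) gt_eqF.
have [ih eh] := csubstitution (onto_powR k0) opos (ccontinuous_gamma (z / k%:C)).
have ig := ih.1 (cintegrable_gamma zk0).
have E t : pos t -> cpow k (z / k%:C - 1) *
    (cpow (t `^ k / k) (z / k%:C - 1) * (expR (- (t `^ k / k)))%:C *
     (t `^ (k - 1))%:C) = cpow t (z - 1) * (expR (- (t `^ k / k)))%:C.
  move=> /posE t0; have tk := powR_gt0 k t0.
  rewrite (cpow_div _ tk k0) (cpow_powR _ _ t0) -(cpow_real _ t0).
  have -> : cpow t (z - 1) = cpow t (k%:C * (z / k%:C - 1)) * cpow t (k - 1)%:C.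
    by rewrite -cpowD; congr cpow; rewrite rmorphB rmorph1; field.
  by field; rewrite cpow_neq0.
rewrite (Gamma_euler zk0) /euler_gamma eh -(cintegralZ _ mpos ig).2.
exact/esym/eq_cintegral.
Qed.

(** Once [Re (w + n) >= 1], going from [n] to [n + 1] divides the inverse by a
    number of modulus at least 1; the finitely many earlier terms are bounded by
    their sum. *)
Lemma Gamma_inv_bounded w : exists2 M : R, 0 <= M &
  forall n : nat, normc (Gamma (w + n%:R))^-1 <= M.
Proof.
pose r (n : nat) := normc (Gamma (w + n%:R))^-1.
have r0 n : 0 <= r n by exact: normc_ge0.
pose N := (Num.truncn (1 - complex.Re w)).+1.
have NP : 1 < complex.Re w + N%:R.
  by rewrite -ltrBlDl; exact: truncnS_gt.
have dec n : r (N + n).+1 <= r (N + n)%N.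
  have R1 : 1 <= complex.Re (w + (N + n)%:R).
    rewrite ReD natrC /= natrD addrA; apply: (le_trans (ltW NP)).
    by rewrite lerDl.
  have R0 : 0 < complex.Re (w + (N + n)%:R) by exact: lt_le_trans R1.
  have -> : r (N + n).+1 = r (N + n)%N * (normc (w + (N + n)%:R))^-1.
    rewrite /r -natr1 addrA !Gamma_euler//; last by rewrite ReD addr_gt0 /=.
    by rewrite (gamma_rec R0) invfM normcM [normc (w + _)^-1]normcV mulrC.
  rewrite ler_piMr// invf_le1; last first.
    apply: lt_le_trans (normc_geRe _); rewrite normr_gt0; exact: lt0r_neq0.
  by apply: le_trans (normc_geRe _); rewrite ger0_norm// ltW.
have tail n : r (N + n)%N <= r N.
  elim: n => [|n IH]; first by rewrite addn0.
  by rewrite addnS; exact: le_trans (dec n) IH.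
exists (\sum_(i < N.+1) r i); first by apply: sumr_ge0 => i _.
have le_sum m : (m < N.+1)%N -> r m <= \sum_(i < N.+1) r i.
  move=> mN; rewrite (bigD1 (Ordinal mN))//= lerDl.
  by apply: sumr_ge0 => i _.
move=> n; have [nN|Nn] := ltnP n N.+1; first exact: le_sum.
apply: le_trans (le_sum N (ltnSn _)).
by have := tail (n - N)%N; rewrite subnKC// ltnW.
Qed.

End gamma_consequences.

(** * The terms of the k-Bessel series *)

Section kBessel.
Variable R : realType.
Implicit Types (z a b s v : R[i]) (k t c x : R).

(** Separates the dependence on [n]: a coefficient of the exponential series,
    the reciprocal Gamma factor, and a power of [t]. *)
Lemma kBessel_termE k c v t n : 0 < k -> 0 < t ->
  kBessel_term k c v t n =
  (cpow (2 * k) (v / k%:C))^-1 * (Gamma (v / k%:C + 1 + n%:R))^-1 *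
  (exp_coeff (- c / (4 * k)) n)%:C * cpow t ((2 * n)%:R + v / k%:C).
Proof.
move=> k0 t0; rewrite /kBessel_term GammakE//.
have kC : k%:C != 0 by rewrite (inj_eq (@complexI R)) gt_eqF.
have -> : (n%:R * k%:C + v + k%:C) / k%:C = v / k%:C + 1 + n%:R by field.
have -> : v / k%:C + 1 + n%:R - 1 = n%:R + v / k%:C by ring.
have two0 : 0 < 2 :> R by [].
rewrite (cpow_div _ t0 two0) (cpowM _ two0 k0).
rewrite [cpow k _]cpowD [cpow 2 (_ + _)]cpowD (cpow_nat _ k0) (cpow_nat _ two0).
have -> : (exp_coeff (- c / (4 * k)) n)%:C =
    ((- c) ^+ n)%:C / ((2 ^+ (2 * n))%:C * (k ^+ n)%:C * n`!%:R).
  rewrite natrC -!rmorphM -fmorphV -rmorphM; congr (_%:C).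
  rewrite /exp_coeff /= expr_div_n exprMn exprM [in RHS]invfM mulrA.
  by have -> : 2 ^+ 2 = 4 :> R by ring.
have Pneq0 : (2 ^+ (2 * n))%:C != 0 :> R[i].
  by rewrite (inj_eq (@complexI R)) expf_neq0// gt_eqF.
have kneq0 : (k ^+ n)%:C != 0 :> R[i].
  by rewrite (inj_eq (@complexI R)) expf_neq0// gt_eqF.
have fneq0 : n`!%:R != 0 :> R[i].
  by rewrite pnatr_eq0 -lt0n fact_gt0.
set G := Gamma (v / k%:C + 1 + n%:R).
have -> : ((k ^+ n)%:C * cpow k (v / k%:C) * G * n`!%:R)^-1 =
    G^-1 * ((k ^+ n)%:C * cpow k (v / k%:C) * n`!%:R)^-1.
  by rewrite -[RHS]invfM; congr _^-1; ring.
move: G^-1 => g.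
have c2 := cpow_neq0 2 (v / k%:C); have ck := cpow_neq0 k (v / k%:C).
by field; rewrite c2 ck Pneq0 kneq0 fneq0.
Qed.

(** The bound is a summable sequence times a power of [t] that does not depend
    on [n]; on ]0, x[ the sequence can moreover be taken at [t = x], which is what
    integrating the series termwise requires. *)
Lemma kBessel_term_bound k c v : 0 < k -> exists2 M : R, 0 <= M &
  forall t n, 0 < t -> normc (kBessel_term k c v t n) <=
    M * exp_coeff (`|c| * t ^+ 2 / (4 * k)) n * t `^ complex.Re (v / k%:C).
Proof.
move=> k0; have [M M0 GM] := Gamma_inv_bounded (v / k%:C + 1).
have k20 : 0 < 2 * k by rewrite mulr_gt0.
pose P := normc (cpow (2 * k) (v / k%:C))^-1.
exists (P * M); first by rewrite mulr_ge0// normc_ge0.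
move=> t n t0; rewrite kBessel_termE// mulrC (normc_cpowM _ _ t0).
have -> : complex.Re ((2 * n)%:R + v / k%:C) = (2 * n)%:R + complex.Re (v / k%:C).
  by rewrite ReD natrC.
rewrite powRD ?(gt_eqF t0) ?implybT// powR_mulrn ?(ltW t0)//.
rewrite normcM normc_real normcM -/P.
have -> : exp_coeff (`|c| * t ^+ 2 / (4 * k)) n =
    `|exp_coeff (- c / (4 * k)) n| * t ^+ (2 * n).
  have k40 : 0 <= 4 * k by rewrite mulr_ge0// ltW.
  rewrite /exp_coeff /= normrM normfV normr_nat normrX normrM normrN normfV.
  by rewrite (ger0_norm k40) !expr_div_n exprMn exprM; ring.
set T := t `^ _; set T2 := t ^+ _; set E := `|_|; set r := normc _.
have -> : T2 * T * (P * r * E) = P * T2 * T * E * r by ring.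
have -> : P * M * (E * T2) * T = P * T2 * T * E * M by ring.
apply: ler_wpM2l; last exact: GM.
by rewrite !mulr_ge0 ?normc_ge0 ?powR_ge0 ?exprn_ge0 ?normr_ge0 ?(ltW t0).
Qed.

Lemma ccvg_kBessel k c v t : 0 < k -> 0 < t ->
  ccvg (series (kBessel_term k c v t)) (kBessel k c v t).
Proof.
move=> k0 t0; have [M M0 bM] := kBessel_term_bound c v k0.
pose y := `|c| * t ^+ 2 / (4 * k).
apply: (@ccvg_series_dom _ _ (fun n => t `^ complex.Re (v / k%:C) * M * exp_coeff y n)).
  by move=> n; apply: le_trans (bM t n t0) _; rewrite mulrC mulrA.
by apply: is_cvg_seriesZ; exact: is_cvg_series_exp_coeff.
Qed.

(** The factors [Gamma(s + 2n) / Gamma(s + a + 2n)] of the Wright series come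
    from the Beta integral, the factor [1 / Gamma(v/k + 1 + n)] from the
    k-Bessel coefficients. *)
Lemma RL_kBessel_term k c x a la v n : 0 < k -> 0 < x ->
  0 < complex.Re a -> 0 < complex.Re (la + v) ->
  let s := v / k%:C + la / k%:C in
  let h := fun t => cpow (x - t) (a - 1) *
    (cpow t (la / k%:C - 1) * kBessel_term k c v t n) in
  cintegral `]0, x[ h =
  (cpow (2 * k) (v / k%:C))^-1 * Gamma a * cpow x (s + a - 1) *
  Wright_term [:: (s, 2)] [:: (s + a, 2); (v / k%:C + 1, 1)]
    (- (c * x ^+ 2 / (4 * k)))%:C n.
Proof.
move=> k0 x0 a0 lv0 s h.
have s0 : 0 < complex.Re s by rewrite /s -mulrDl addrC Re_divr divr_gt0.
have sn0 : 0 < complex.Re (s + (2 * n)%:R).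
  by rewrite ReD natrC ltr_pwDl.
have asn0 : 0 < complex.Re (a + (s + (2 * n)%:R)) by rewrite ReD addr_gt0.
set K := (cpow (2 * k) (v / k%:C))^-1 * (Gamma (v / k%:C + 1 + n%:R))^-1 *
  (exp_coeff (- c / (4 * k)) n)%:C.
have [ip ep] := RL_power x0 a0 sn0.
have mx : measurable (`]0%R, x[%classic : set (measurableTypeR R)).
  exact: measurable_itv.
have E t : `]0%R, x[%classic t ->
    h t = K * (cpow (x - t) (a - 1) * cpow t (s + (2 * n)%:R - 1)).
  rewrite /= in_itv/= => /andP[t0 tx].
  rewrite /h kBessel_termE// -/K.
  have -> : s + (2 * n)%:R - 1 = (la / k%:C - 1) + ((2 * n)%:R + v / k%:C).
    by rewrite /s; ring.
  rewrite [cpow t (_ + ((2 * n)%:R + _))]cpowD.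
  move: (cpow _ _) (cpow _ _) (cpow _ _) => A B C; ring.
rewrite (eq_cintegral E) (cintegralZ K mx ip).2 ep.
have two_n : (2 * n%:R)%:C = (2 * n)%:R :> R[i].
  by rewrite natrC natrM.
rewrite /Wright_term !big_cons !big_nil !mulr1 /fst /snd mul1r -natrC two_n.
rewrite (Gamma_euler a0) (Gamma_euler sn0).
have -> : s + a + (2 * n)%:R = a + (s + (2 * n)%:R) by ring.
rewrite (Gamma_euler asn0).
have -> : a + (s + (2 * n)%:R) - 1 = (s + a - 1) + (2 * n)%:R by ring.
rewrite [cpow x (_ + (2 * n)%:R)]cpowD (cpow_nat _ x0).
have zE : (exp_coeff (- c / (4 * k)) n)%:C * (x ^+ (2 * n))%:C =
    (- (c * x ^+ 2 / (4 * k)))%:C ^+ n / n`!%:R.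
  rewrite natrC -rmorphXn -fmorphV -!rmorphM; congr (_%:C).
  rewrite /exp_coeff/= mulrAC exprM -exprMn; congr (_ ^+ n / _).
  by ring.
rewrite -zE /K.
have inv2 (p q : R[i]) : (p * q)^-1 = p^-1 * q^-1 by exact: invfM.
by rewrite [X in _ = _ * (_ * X * _)]inv2; ring.
Qed.

End kBessel.

(** * The fractional integral of the k-Bessel function *)

(** [RL_power] at real parameters: this weight dominates the terms of the
    series. *)
Lemma RL_weight_integrable (R : realType) (x : R) (a s : R) : 0 < x -> 0 < a -> 0 < s ->
  (@lebesgue_measure R).-integrable `]0, x[
    (EFin \o (fun t => (x - t) `^ (a - 1) * t `^ (s - 1))).
Proof.
move=> x0 a0 s0; have [[i _] _] := @RL_power R x a%:C s%:C x0 a0 s0.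
apply: eq_integrable i; first exact: measurable_itv.
move=> t /set_mem Dt; congr EFin.
have /andP[t0 tx] : 0 < t < x by move: Dt; rewrite /= in_itv.
have xt : 0 < x - t by rewrite subr_gt0.
rewrite -(rmorphB (real_complex R) a 1) -(rmorphB (real_complex R) s 1).
by rewrite !cpow_real// -rmorphM.
Qed.

Unset Implicit Arguments.

Theorem corollary2p2 (R : realType) (k c x : R) (alpha lambda v : R[i])
    (k_gt0 : 0 < k) (x_gt0 : 0 < x)
    (v_gtN1 : -1 < complex.Re v) (alpha_gt0 : 0 < complex.Re alpha)
    (lambdav_gt0 : 0 < complex.Re (lambda + v)) :
  let f := fun t : R => cpow t (lambda / k%:C - 1) * kBessel k c v t in
  let a := [:: (v / k%:C + lambda / k%:C, 2)] in
  let b := [:: (v / k%:C + lambda / k%:C + alpha, 2); (v / k%:C + 1, 1)] in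
  let z := (- (c * x ^+ 2 / (4 * k)))%:C in
  [/\ forall t : R, 0 < t -> csummable (kBessel_term k c v t),
      cintegrable `]0, x[ (RL_integrand alpha f x),
      csummable (Wright_term a b z)
    & RL_integral alpha f x =
      cpow x (v / k%:C + lambda / k%:C + alpha - 1) / cpow (2 * k) (v / k%:C)
        * Wright a b z].
Proof.
move=> f a b z.
pose s := v / k%:C + lambda / k%:C.
have s0 : 0 < complex.Re s by rewrite /s -mulrDl addrC Re_divr divr_gt0.
have sumW t : 0 < t -> ccvg (series (kBessel_term k c v t)) (kBessel k c v t).
  by move=> t0; exact: ccvg_kBessel.
have mx : measurable (`]0%R, x[%classic : set (measurableTypeR R)).
  exact: measurable_itv.
pose h n t : R[i] := cpow (x - t) (alpha - 1) *
  (cpow t (lambda / k%:C - 1) * kBessel_term k c v t n).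
have hE t : `]0%R, x[%classic t -> csum (h^~ t) = RL_integrand alpha f x t.
  rewrite /= in_itv/= => /andP[t0 _].
  apply: (ccvg_csum _).2; do 2!apply: ccvg_seriesZ; exact: sumW.
have [M M0 bM] := kBessel_term_bound c v k_gt0.
(* For t < x the power of t in the bound is at most its value at x, which makes
   C n independent of t. *)
pose y := `|c| * x ^+ 2 / (4 * k).
pose C n := M * exp_coeff y n.
pose g t := (x - t) `^ (complex.Re alpha - 1) * t `^ (complex.Re s - 1).
have y0 : 0 <= y by rewrite divr_ge0 ?mulr_ge0 ?sqr_ge0// ltW.
have C0 n : 0 <= C n by rewrite mulr_ge0// /exp_coeff /= divr_ge0// exprn_ge0.
have cC : cvgn (series C).
  by apply: is_cvg_seriesZ; exact: is_cvg_series_exp_coeff.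
have ig := RL_weight_integrable x_gt0 alpha_gt0 s0.
have g0 t : `]0%R, x[%classic t -> 0 <= g t.
  by move=> _; rewrite mulr_ge0 ?powR_ge0.
have mh n : cmeasurable (`]0%R, x[%classic : set (measurableTypeR R)) (h n).
  apply: cmeasurableM.
    by apply: cmeasurable_cpow; exact: measurable_funB.
  apply: cmeasurableM; first exact: cmeasurable_cpow.
  apply: cmeasurableM; first exact: cmeasurable_cst.
  by apply: cmeasurable_cpow; exact: measurable_funM.
have hC n t : `]0%R, x[%classic t -> normc (h n t) <= C n * g t.
  rewrite /= in_itv/= => /andP[t0 tx]; have xt : 0 < x - t by rewrite subr_gt0.
  rewrite /h (normc_cpowM _ _ xt) (normc_cpowM _ _ t0).
  have -> : complex.Re (alpha - 1) = complex.Re alpha - 1 by rewrite ReD ReN.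
  have -> : complex.Re (lambda / k%:C - 1) = complex.Re (lambda / k%:C) - 1.
    by rewrite ReD ReN.
  have tE : t `^ (complex.Re s - 1) =
      t `^ (complex.Re (lambda / k%:C) - 1) * t `^ complex.Re (v / k%:C).
    rewrite -powRD; last by rewrite (gt_eqF t0) implybT.
    by congr (_ `^ _); rewrite ReD; ring.
  rewrite /g tE.
  have -> : C n * ((x - t) `^ (complex.Re alpha - 1) *
     (t `^ (complex.Re (lambda / k%:C) - 1) * t `^ complex.Re (v / k%:C))) =
     (x - t) `^ (complex.Re alpha - 1) * (t `^ (complex.Re (lambda / k%:C) - 1) *
      (C n * t `^ complex.Re (v / k%:C))) by ring.
  rewrite ler_wpM2l ?powR_ge0// ler_wpM2l ?powR_ge0//.
  apply: (le_trans (bM t n t0)); rewrite ler_wpM2r ?powR_ge0// /C ler_wpM2l//.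
  rewrite /exp_coeff /= ler_wpM2r ?invr_ge0//.
  have k4 : 0 <= (4 * k)^-1 by rewrite invr_ge0 mulr_ge0// ltW.
  have t2 : t ^+ 2 <= x ^+ 2 by rewrite ler_sqr ?nnegrE ltW.
  apply: lerXn2r; rewrite ?nnegrE//.
    by rewrite mulr_ge0// mulr_ge0// sqr_ge0.
  by rewrite ler_wpM2r// ler_wpM2l.
have [ih cvgh] := cintegral_series mx mh ig g0 C0 cC hC.
set I := cintegral _ _ in cvgh.
pose K := (cpow (2 * k) (v / k%:C))^-1 * Gamma alpha * cpow x (s + alpha - 1).
have G0 : Gamma alpha != 0 by rewrite Gamma_euler// gamma_neq0.
have K0 : K != 0.
  apply: mulf_neq0; last exact: cpow_neq0.
  by apply: mulf_neq0 => //; rewrite invr_eq0 cpow_neq0.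
have WE : Wright_term a b z = fun n => K^-1 * cintegral `]0, x[ (h n).
  by apply/funext => n; rewrite RL_kBessel_term// mulKf.
have [cW eW] : csummable (Wright_term a b z) /\ Wright a b z = K^-1 * I.
  by apply: ccvg_csum; rewrite WE; exact: ccvg_seriesZ.
split.
- by move=> t t0; have [] := ccvg_csum (sumW t t0).
- exact: eq_cintegrable mx hE ih.
- exact: cW.
- rewrite /RL_integral -(eq_cintegral hE) -/I eW /K -/s.
  by field; rewrite G0 !cpow_neq0.
Qed.
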